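(* Let $A$ be a connected graded $\Bbbk$-algebra, $f\in A_m$ a regular normal element with $m\ge 1$, and $B=A/(f)$. Let $P_\bullet=(P_i,d_i)\xrightarrow{\sim}\Bbbk_A$ be a minimal graded free resolution of the right module $\Bbbk_A=A/A_{\geq 1}$, and let $T_\bullet=(T_i,\partial_i)$ be the sequence of free graded right $B$-modules constructed from $P_\bullet$ as described in the context. Then $T_\bullet$ is a free resolution of $\Bbbk_B$. If in addition $A$ is Koszul and $m\ge 2$, then $T_\bullet\xrightarrow{\sim}\Bbbk_B$ is a minimal resolution.
   Context: $\Bbbk$ is an algebraically closed field of characteristic $0$. A graded algebra $A=\bigoplus_i A_i$ is connected graded if $A_0=\Bbbk$ and $A_i=0$ for $i<0$. Modules are graded right modules with degree-preserving homomorphisms; $M(n)_i=M_{n+i}$. An element $f\in A_m$ is regular if $af=0$ or $fa=0$ implies $a=0$, and normal if $Af=fA$. For $f$ regular normal there is a unique graded automorphism $\sigma$ of $A$ (the normalizing automorphism) with $fa=\sigma(a)f$ for all $a\in A$; put $\tau=\sigma^{-1}$. $A$ is Koszul if $\Bbbk_A$ has a resolution by graded projectives $P_i$ generated in degree $i$ (a linear resolution). Fix homogeneous bases of the free modules $P_i$; elements are column vectors over $A$ and morphisms between free modules are matrices over $A$ acting by left multiplication. For a matrix $\varphi=(\varphi_{ij})$ over $A$ put $\tau^k\cdot\varphi=(\tau^k(\varphi_{ij}))$. Put $P_i=0$ for $i<0$ and $d_i=0$ for $i\leq 0$. Construction of $T_\bullet$. Put $c^0_l=d_l:P_l\to P_{l-1}$.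 Choose degree-preserving right $A$-module morphisms $c^n_l:P_l(-nm)\to P_{l+2n-1}$ for $n\ge 1$, $l\in\mathbb Z$ (with $c^n_l=0$ for $l<0$), such that for all $l\geq 0$ $$c^1_{l-1}(\tau\cdot d_l)+d_{l+1}c^1_l=f\,I\quad(\text{as a morphism }P_l(-m)\to P_l,\ I\text{ the identity matrix}),$$ and for all $n\ge 2$ $$\sum_{0\le i\le n}c^i_{l+2(n-i)-1}\,(\tau^i\cdot c^{n-i}_l)=0 .$$ Such families exist; any choice is allowed. Set $$T_i=\bigoplus_{0\le k\le\lfloor i/2\rfloor}P_{i-2k}(-km)\otimes_A B\quad (i\geq 0),$$ and let $\partial_i:T_i\to T_{i-1}$ ($i\ge1$) be the block upper triangular map whose component from the summand $P_{i-2b}(-bm)\otimes_AB$ of $T_i$ to the summand $P_{i-1-2a}(-am)\otimes_AB$ of $T_{i-1}$ is $(\tau^a\cdot c^{\,b-a}_{i-2b})\otimes_A B$ if $a\le b$, and $0$ if $a>b$. The augmentation $T_0=P_0\otimes_AB\to\Bbbk_B$ is induced by the augmentation $P_0\to\Bbbk_A$. *)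

(* Defs.v *)
From HB Require Import structures.
From mathcomp Require Import all_boot all_order all_algebra.
From mathcomp Require Import finmap monalg.
From mathcomp Require Import boolp.

Set Implicit Arguments.
Unset Strict Implicit.
Unset Printing Implicit Defensive.

Import Order.TTheory GRing.Theory Num.Theory.
Local Open Scope ring_scope.

(** [M] is the internal direct sum of its additive subgroups [G i], [i : int].
    Finite sums over [int] are indexed by duplicate-free lists. *)
Record is_grading (M : zmodType) (G : int -> M -> Prop) : Prop := IsGrading {
  grading0 : forall i, G i 0;
  gradingB : forall i x y, G i x -> G i y -> G i (x - y);
  grading_span : forall x, exists (S : seq int) (c : int -> M),
    [/\ uniq S, forall i, G i (c i), forall i, i \notin S -> c i = 0
      & x = \sum_(i <- S) c i];
  grading_free : forall (S : seq int) (c : int -> M),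
    uniq S -> (forall i, G i (c i)) -> \sum_(i <- S) c i = 0 ->
    forall i, i \in S -> c i = 0 }.

Lemma gradingN (M : zmodType) (G : int -> M -> Prop) i x :
  is_grading G -> G i x -> G i (- x).
Proof. by move=> gG Gx; rewrite -[- x]add0r; exact: (gradingB gG (grading0 gG i) Gx). Qed.

Lemma gradingD (M : zmodType) (G : int -> M -> Prop) i x y :
  is_grading G -> G i x -> G i y -> G i (x + y).
Proof.
by move=> gG Gx Gy; rewrite -[y]opprK; apply: (gradingB gG Gx); exact: gradingN.
Qed.

(** The sums of elements that are homogeneous of some degree in [D]. *)
Inductive gspan (M : zmodType) (G : int -> M -> Prop) (D : pred int) : M -> Prop :=
| gspan0 : gspan G D 0
| gspanD i x y : D i -> G i x -> gspan G D y -> gspan G D (x + y).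

Lemma gspan_add (M : zmodType) (G : int -> M -> Prop) (D : pred int) x y :
  gspan G D x -> gspan G D y -> gspan G D (x + y).
Proof.
move=> Gx Gy; elim: Gx => [|i u v Di Gu _ IH]; first by rewrite add0r.
by rewrite -addrA; exact: (gspanD Di Gu IH).
Qed.

Lemma gspan_opp (M : zmodType) (G : int -> M -> Prop) (D : pred int) x :
  is_grading G -> gspan G D x -> gspan G D (- x).
Proof.
move=> gG; elim=> [|i u v Di Gu _ IH]; first by rewrite oppr0; exact: gspan0.
by rewrite opprD; exact: (gspanD Di (gradingN gG Gu) IH).
Qed.

Lemma gspan_sum (M : zmodType) (G : int -> M -> Prop) (D : pred int)
    (S : seq int) (c : int -> M) :
  (forall i, G i (c i)) -> (forall i, i \in S -> D i \/ c i = 0) ->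
  gspan G D (\sum_(i <- S) c i).
Proof.
move=> Gc; elim: S => [|j S IH] DS; first by rewrite big_nil; exact: gspan0.
have {IH} cS : gspan G D (\sum_(i <- S) c i).
  by apply: IH => i iS; apply: DS; rewrite in_cons iS orbT.
rewrite big_cons; case: (DS j (mem_head _ _)) => [Dj | ->]; last by rewrite add0r.
exact: (gspanD Dj (Gc j) cS).
Qed.

Lemma gspan_family (M : zmodType) (G : int -> M -> Prop) (D : pred int) x :
  is_grading G -> gspan G D x ->
  exists (S : seq int) (c : int -> M),
    [/\ uniq S, forall i, i \in S -> D i, forall i, G i (c i)
      & x = \sum_(i <- S) c i].
Proof.
move=> gG; elim=> [|i u v Di Gu _ [S [c [uS DS Gc ->]]]].
  by exists [::], (fun _ => 0); split=> // [i|]; [exact: grading0 | rewrite big_nil].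
case iS: (i \in S); last first.
  exists (i :: S), (fun j => if j == i then u else c j); split=> /=.
  - by rewrite iS.
  - by move=> j; rewrite in_cons => /orP[/eqP -> | /DS].
  - by move=> j; case: eqP => // ->.
  - rewrite big_cons eqxx; congr (_ + _); apply: eq_big_seq => j jS.
    by case: eqP => // ji; rewrite ji iS in jS.
exists S, (fun j => if j == i then u + c j else c j); split=> //.
  by move=> j; case: eqP => // ->; exact: gradingD.
rewrite (bigD1_seq i) //= [RHS](bigD1_seq i) //= eqxx addrA; congr (_ + _).
by apply: eq_bigr => j /negbTE ->.
Qed.

(** That [1] has degree 0 and that every component is a [k]-subspace follows
    from [cga_deg0] and [cga_mul]. *)
Record cgAlg (k : fieldType) := CGAlg {
  cga_car :> algType k;
  cga_gr : int -> cga_car -> Prop;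
  cga_grading : is_grading cga_gr;
  cga_mul : forall i j a b, cga_gr i a -> cga_gr j b -> cga_gr (i + j) (a * b);
  cga_neg : forall i a, i < 0 -> cga_gr i a -> a = 0;
  cga_deg0 : forall a, cga_gr 0 a <-> exists c : k, a = c%:A }.

(** The ideal [A_{>=1}]. *)
Definition aug_ideal (k : fieldType) (A : cgAlg k) : A -> Prop :=
  gspan (@cga_gr k A) (fun i => 1 <= i).

Section Augmentation.
Context {k : fieldType} {A : cgAlg k}.
Implicit Types (a b : A) (c : k).
Let gA := @cga_grading k A.

Lemma cga_gr_scalar c : cga_gr 0 (c%:A : A).
Proof. by apply/cga_deg0; exists c. Qed.

Lemma aug_ideal_scalar c : aug_ideal (c%:A : A) -> c = 0.
Proof.
move=> /(gspan_family gA)[S [g [uS DS Gg cE]]].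
have S0 : 0 \notin S by apply/negP => /DS.
pose h i := if i == 0 then - (c%:A) else g i.
suff /eqP : h 0 = 0.
  by rewrite /h eqxx oppr_eq0 scaler_eq0 oner_eq0 orbF => /eqP.
apply: (grading_free gA (S := 0 :: S)); last exact: mem_head.
- by rewrite /= S0.
- move=> i; rewrite /h; case: eqP => // ->; apply: (gradingN gA).
  exact: cga_gr_scalar.
- rewrite big_cons {1}/h eqxx cE addrC; apply/eqP; rewrite subr_eq0; apply/eqP.
  apply: eq_big_seq => i iS; rewrite /h; case: eqP => // i0.
  by rewrite i0 (negbTE S0) in iS.
Qed.

Lemma aug_ideal_mulhl i a b : 0 <= i -> cga_gr i a -> aug_ideal b ->
  aug_ideal (a * b).
Proof.
move=> i0 Ga; elim=> [|j u v j1 Gu _ IH]; first by rewrite mulr0; exact: gspan0.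
rewrite mulrDr; apply: (gspanD _ (cga_mul Ga Gu) IH).
by rewrite -[1]add0r lerD.
Qed.

Lemma aug_ideal_mulhr i a b : 0 <= i -> cga_gr i a -> aug_ideal b ->
  aug_ideal (b * a).
Proof.
move=> i0 Ga; elim=> [|j u v j1 Gu _ IH]; first by rewrite mul0r; exact: gspan0.
rewrite mulrDl; apply: (gspanD _ (cga_mul Gu Ga) IH).
by rewrite -[1]addr0 lerD.
Qed.

Lemma cga_span0 a : gspan (@cga_gr k A) (fun i => 0 <= i) a.
Proof.
have [S [g [uS Gg _ ->]]] := grading_span gA a.
apply: gspan_sum => // i _; case: (lerP 0 i) => [|i0]; first by left.
by right; apply: (cga_neg i0).
Qed.

Lemma aug_ideal_mull a b : aug_ideal b -> aug_ideal (a * b).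
Proof.
move=> Ab; elim: (cga_span0 a) => [|i u v i0 Gu _ IH].
  by rewrite mul0r; exact: gspan0.
by rewrite mulrDl; exact: gspan_add (aug_ideal_mulhl i0 Gu Ab) IH.
Qed.

Lemma aug_ideal_mulr a b : aug_ideal b -> aug_ideal (b * a).
Proof.
move=> Ab; elim: (cga_span0 a) => [|i u v i0 Gu _ IH].
  by rewrite mulr0; exact: gspan0.
by rewrite mulrDr; exact: gspan_add (aug_ideal_mulhr i0 Gu Ab) IH.
Qed.

Lemma aug_subproof a : exists c, aug_ideal (a - c%:A).
Proof.
elim: (cga_span0 a) => [|i u v i0 Gu _ [c Ac]].
  by exists 0; rewrite scale0r subr0; exact: gspan0.
have [i1 | i1] := lerP 1 i.
  by exists c; rewrite -addrA; exact: (gspanD i1 Gu Ac).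
have i00 : i = 0 by apply/eqP; rewrite eq_le i0 andbT -ltzD1 add0r.
have [e uE] : exists e : k, u = e%:A by apply/cga_deg0; rewrite -i00.
by exists (e + c); rewrite uE scalerDl opprD addrACA subrr add0r.
Qed.

(** The augmentation of [A]: the degree-0 component, seen as a scalar. *)
Definition aug a : k := sval (cid (aug_subproof a)).

Lemma augP a : aug_ideal (a - (aug a)%:A).
Proof. exact: svalP (cid (aug_subproof a)). Qed.

Lemma aug_unique a c : aug_ideal (a - c%:A) -> aug a = c.
Proof.
move=> /(gspan_opp gA) Ac; apply/eqP; rewrite eq_sym -subr_eq0; apply/eqP.
apply: aug_ideal_scalar; rewrite scalerBl.
have -> : c%:A - (aug a)%:A = - (a - c%:A) + (a - (aug a)%:A) :> A.
  by rewrite opprB addrA subrK.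
exact: gspan_add Ac (augP a).
Qed.

Lemma aug1 : aug 1 = 1.
Proof. by apply: aug_unique; rewrite scale1r subrr; exact: gspan0. Qed.

Lemma augD a b : aug (a + b) = aug a + aug b.
Proof.
apply: aug_unique; rewrite scalerDl opprD addrACA.
exact: gspan_add (augP a) (augP b).
Qed.

Lemma augM a b : aug (a * b) = aug a * aug b.
Proof.
apply: aug_unique.
have -> : a * b - (aug a * aug b)%:A =
    (a - (aug a)%:A) * b + (aug a)%:A * (b - (aug b)%:A).
  by rewrite mulrBl mulrBr addrA subrK -scalerAl mul1r scalerA.
apply: gspan_add; first exact: aug_ideal_mulr (augP a).
exact: aug_ideal_mull (augP b).
Qed.

End Augmentation.

(** A right [A]-module is a left module over the converse ring [A^c]: for
    [a : A], the product [x . a] is [(a : A^c) *: x]. *)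
Record grMod (k : fieldType) (A : cgAlg k) := GrMod {
  grm_car :> lmodType A^c;
  grm_gr : int -> grm_car -> Prop;
  grm_grading : is_grading grm_gr;
  grm_act : forall i j x a, grm_gr i x -> cga_gr j a ->
    grm_gr (i + j) ((a : A^c) *: x) }.

Section GradedModules.
Context {k : fieldType} {A : cgAlg k}.

Definition ghom (M N : grMod A) (h : M -> N) : Prop :=
  linear h /\ (forall i x, grm_gr i x -> grm_gr i (h x)).

(** Exactness of [... -> P 1 -> P 0 -> N -> 0]; [d i] goes from [P i.+1] to
    [P i]. *)
Definition gresolution (N : grMod A) (P : nat -> grMod A)
    (d : forall i, P i.+1 -> P i) (eps : P 0 -> N) : Prop :=
  [/\ ghom eps, forall i, ghom (d i),
      forall y, exists x, eps x = y,
      forall x, eps x = 0 <-> exists y, x = d 0 y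
    & forall i x, d i x = 0 <-> exists y, x = d i.+1 y].

(** The submodule of [M] spanned by the products [x . a] with [x] in [X] and
    [a] in [D]. *)
Inductive rspan (M : grMod A) (X : M -> Prop) (D : A -> Prop) : M -> Prop :=
| rspan0 : rspan X D 0
| rspanD x a y : X x -> D a -> rspan X D y -> rspan X D ((a : A^c) *: x + y).

(** Minimality of a complex: each differential maps into [P i . A_{>=1}]. *)
Definition gminimal (P : nat -> grMod A) (d : forall i, P i.+1 -> P i) : Prop :=
  forall i x, rspan (fun=> True) (@aug_ideal k A) (d i x).

Definition gminimal_resolution (N : grMod A) (P : nat -> grMod A)
    (d : forall i, P i.+1 -> P i) (eps : P 0 -> N) : Prop :=
  gresolution d eps /\ gminimal d.

Definition gprojective (P : grMod A) : Prop :=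
  forall (M N : grMod A) (g : M -> N) (h : P -> N),
    ghom g -> (forall y, exists x, g x = y) -> ghom h ->
    exists2 h' : P -> M, ghom h' & forall x, g (h' x) = h x.

Definition generated_in_degree (M : grMod A) (n : int) : Prop :=
  forall x : M, rspan (grm_gr n) (fun=> True) x.

End GradedModules.

(** The trivial module [A / A_{>=1}]: its carrier is [k], in degree 0, on which
    [A] acts through the augmentation. *)
Definition triv_car (k : fieldType) (A : cgAlg k) : Type := k.
HB.instance Definition _ (k : fieldType) (A : cgAlg k) :=
  GRing.Zmodule.on (triv_car A).

Section TrivialModule.
Variables (k : fieldType) (A : cgAlg k).

Let triv_scale (a : A^c) (x : triv_car A) : triv_car A := aug (a : A) * (x : k).

Fact triv_scaleA a b x : triv_scale a (triv_scale b x) = triv_scale (a * b) x.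
Proof. by rewrite /triv_scale mulrA -augM mulrC [RHS]mulrC augM (mulrC (aug _)) -augM. Qed.
Fact triv_scale1 : left_id 1 triv_scale.
Proof. by move=> x; rewrite /triv_scale aug1 mul1r. Qed.
Fact triv_scaleDr : right_distributive triv_scale +%R.
Proof. by move=> a x y; exact: mulrDr. Qed.
Fact triv_scaleDl x : {morph triv_scale^~ x : a b / a + b}.
Proof. by move=> a b; rewrite /triv_scale augD; exact: mulrDl. Qed.

HB.instance Definition _ := GRing.Zmodule_isLmodule.Build A^c (triv_car A)
  triv_scaleA triv_scale1 triv_scaleDr triv_scaleDl.

Definition triv_gr (i : int) (x : triv_car A) : Prop := i = 0 \/ x = 0.

Fact triv_grading : is_grading triv_gr.
Proof.
split.
- by move=> i; right.
- move=> i x y [-> | ->]; first by left.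
  by move=> [-> | ->]; [left | right; rewrite subrr].
- move=> x; exists [:: 0], (fun i => if i == 0 then x else 0); split=> //.
  + by move=> i; case: eqP => [-> | _]; [left | right].
  + by move=> i; rewrite inE => /negbTE ->.
  + by rewrite big_seq1 eqxx.
- move=> S c uS Gc c0 i iS; case: (Gc i) => // i0.
  move: c0; rewrite (bigD1_seq i) //= big1 ?addr0 // => j.
  by rewrite i0 => j0; case: (Gc j) => // /eqP; rewrite (negbTE j0).
Qed.

Fact triv_act i j (x : triv_car A) (a : A) :
  triv_gr i x -> cga_gr j a -> triv_gr (i + j) ((a : A^c) *: x).
Proof.
case=> [-> | ->] Ga; last by right; rewrite scaler0.
rewrite add0r; have [j0 | j0] := eqVneq j 0; [by left | right].
suff a0 : aug a = 0 by change (aug a * (x : k) = 0); rewrite a0 mul0r.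
apply: aug_unique; rewrite scale0r subr0 -[a]addr0.
have [j1 | j1] := lerP 1 j; first exact: gspanD j1 Ga (gspan0 _ _).
rewrite (cga_neg _ Ga) ?addr0; first exact: gspan0.
by rewrite lt_neqAle j0 -ltzD1 add0r.
Qed.

Definition triv_mod : grMod A := GrMod triv_grading triv_act.

End TrivialModule.

(** [{malg A^c[I]}] is the right [A]-module of column vectors over [A] with
    rows indexed by [I] and finitely many nonzero entries, [v@_x] being the
    entry of [v] in row [x]; over the converse ring its scaling multiplies the
    entries on the right. *)
Section FreeModule.
Context {k : fieldType} {A : cgAlg k} {I : choiceType} (deg : I -> int).

Definition free_gr (n : int) (v : {malg A^c[I]}) : Prop :=
  forall x, cga_gr (n - deg x) (v@_x : A).

Fact free_grading : is_grading free_gr.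
Proof.
have gA := @cga_grading k A.
split.
- by move=> n x; rewrite mcoeff0; exact: (grading0 gA).
- by move=> n u v Gu Gv x; rewrite mcoeffB; exact: (gradingB gA (Gu x) (Gv x)).
- move=> v; have /boolp.choice[D DP] : forall a : A, exists D : seq int * (int -> A),
      [/\ uniq D.1, forall i, cga_gr i (D.2 i),
        forall i, i \notin D.1 -> D.2 i = 0 & a = \sum_(i <- D.1) D.2 i].
    by move=> a; have [S [g H]] := grading_span gA a; exists (S, g).
  pose S := undup [seq deg x + j | x <- msupp v, j <- (D (v@_x : A)).1].
  pose c n : {malg A^c[I]} :=
    [malg x in msupp v => ((D (v@_x : A)).2 (n - deg x) : A^c)].
  have cE n x : (c n)@_x =
      if x \in msupp v then (D (v@_x : A)).2 (n - deg x) else 0.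
    by rewrite mcoeffE.
  exists S, c; split; first exact: undup_uniq.
  + move=> n x; rewrite cE; case: ifP => _; last exact: (grading0 gA).
    by case: (DP (v@_x : A)).
  + move=> n nS; apply/malgP => x; rewrite cE mcoeff0; case: ifP => // xv.
    have [_ _ D0 _] := DP (v@_x : A); apply: D0; apply: contra nS => jD.
    rewrite mem_undup; apply/allpairsPdep; exists x, (n - deg x).
    by rewrite xv jD addrC subrK.
  + apply/malgP => x; rewrite raddf_sum /=.
    have [xv|xv] := boolP (x \in msupp v); last first.
      rewrite mcoeff_outdom // big1 // => n _; by rewrite cE (negbTE xv).
    have [uD _ D0 DE] := DP (v@_x : A).
    pose F n : A := (D (v@_x : A)).2 (n - deg x).
    rewrite (eq_bigr F); last by move=> n _; rewrite cE xv.
    pose S' := [seq deg x + j | j <- (D (v@_x : A)).1].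
    rewrite (bigID (mem S')) /= [X in _ + X]big1 ?addr0; last first.
      move=> n nS'; apply: D0; apply: contra nS' => jD.
      by apply/mapP; exists (n - deg x) => //; rewrite addrC subrK.
    rewrite -big_filter (perm_big S') /=; last first.
      apply: uniq_perm; first by rewrite filter_uniq ?undup_uniq.
        by rewrite map_inj_uniq //; exact: addrI.
      move=> n; rewrite mem_filter andb_idr // => /mapP[j jD ->].
      by rewrite mem_undup; apply/allpairsPdep; exists x, j.
    rewrite big_map [LHS]DE; apply: eq_bigr => j _.
    by rewrite /F addrAC subrr add0r.
- move=> S c uS Gc c0 n nS; apply/malgP => x; rewrite mcoeff0.
  pose h j : A := (c (j + deg x))@_x.
  have := grading_free gA (S := [seq n - deg x | n <- S]) (c := h).
  rewrite map_inj_uniq; last exact: addIr.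
  move=> /(_ uS) H; rewrite -[n](subrK (deg x)); apply: H.
  + by move=> j; have := Gc (j + deg x) x; rewrite addrK.
  + rewrite big_map; transitivity ((\sum_(i <- S) c i)@_x); last first.
      by rewrite c0 mcoeff0.
    by rewrite raddf_sum; apply: eq_bigr => i _; rewrite /h subrK.
  + exact: map_f.
Qed.

Fact free_act i j (v : {malg A^c[I]}) (a : A) :
  free_gr i v -> cga_gr j a -> free_gr (i + j) ((a : A^c) *: v).
Proof.
move=> Gv Ga x; rewrite mcoeffZ addrAC.
exact: (cga_mul (Gv x) Ga).
Qed.

(** The graded free module with homogeneous basis [<< 1 *g x >>], [x : I], the
    basis element of index [x] having degree [deg x]. *)
Definition free_mod : grMod A := GrMod free_grading free_act.

End FreeModule.
Arguments free_mod {k} A {I} deg.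

(** Matrices over [A] with columns indexed by [I], rows indexed by [J], and
    finitely many nonzero entries in each column: [phi x] is the column of
    index [x]. *)
Definition cfmx (k : fieldType) (A : cgAlg k) (I J : choiceType) : Type :=
  I -> {malg A^c[J]}.

Section Matrices.
Context {k : fieldType}.

(** The right [A]-linear map sending the basis element of index [x] to [phi x];
    when [phi] is a matrix it is the left multiplication by [phi]. *)
Definition lin_ext {A : cgAlg k} {I : choiceType} {M : lmodType A^c}
    (phi : I -> M) (v : {malg A^c[I]}) : M :=
  \sum_(x <- msupp v) v@_x *: phi x.

Definition cfmx_mul {A : cgAlg k} {I J L : choiceType}
    (phi : cfmx A J L) (psi : cfmx A I J) : cfmx A I L :=
  fun x => lin_ext phi (psi x).

Definition cfmx_scalar {A : cgAlg k} {I : choiceType} (a : A) : cfmx A I I :=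
  fun x => << (a : A^c) *g x >>.

Definition cfmx_map {A B : cgAlg k} {I J : choiceType} (g : A -> B)
    (phi : cfmx A I J) : cfmx B I J :=
  fun x => [malg y in msupp (phi x) => (g (phi x)@_y : B^c)].

(** [phi] is a degree-preserving morphism [P(- s) -> Q], where [P] and [Q] are
    the free modules with basis degrees [degI] and [degJ]. *)
Definition cfmx_hom {A : cgAlg k} {I J : choiceType} (degI : I -> int)
    (degJ : J -> int) (s : int) (phi : cfmx A I J) : Prop :=
  forall x, free_gr degJ (degI x + s) (phi x).

End Matrices.

Definition koszul (k : fieldType) (A : cgAlg k) : Prop :=
  exists (P : nat -> grMod A) (d : forall i, P i.+1 -> P i)
         (eps : P 0 -> triv_mod A),
    gresolution d eps /\
    forall i, gprojective (P i) /\ generated_in_degree (P i) i%:Z.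

Section NormalElements.
Context {k : fieldType} {A : cgAlg k}.

Definition regular_elt (f : A) : Prop :=
  forall a, a * f = 0 \/ f * a = 0 -> a = 0.

Definition normal_elt (f : A) : Prop :=
  forall x, (exists a, x = a * f) <-> (exists a, x = f * a).

Definition normalizing_aut (f : A) (sigma : {lrmorphism A -> A}) : Prop :=
  [/\ bijective sigma, forall i a, cga_gr i (sigma a) <-> cga_gr i a
    & forall a, f * a = sigma a * f].

(** [pi] presents [B] as the graded algebra [A / (f)]. *)
Definition graded_quotient (f : A) (B : cgAlg k) (pi : {lrmorphism A -> B}) :
    Prop :=
  [/\ forall b, exists a, pi a = b,
      forall i b, cga_gr i b <-> exists2 a, cga_gr i a & pi a = b
    & forall a, pi a = 0 <->
        exists s : seq (A * A), a = \sum_(p <- s) p.1 * f * p.2].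

End NormalElements.

(** The bases of [P l] for all integers [l], with [P l = 0] when [l < 0]. *)
Definition ext_basis (I : nat -> choiceType) (l : int) : choiceType :=
  match l with Posz n => I n | Negz _ => void end.

Definition ext_deg (I : nat -> choiceType) (deg : forall n, I n -> int)
    (l : int) : ext_basis I l -> int :=
  match l with Posz n => deg n | Negz _ => fun x => match x with end end.

Section Construction.
Context {k : fieldType} {A : cgAlg k} (m : nat) (f : A) (tau : A -> A).
Context (I : nat -> choiceType) (deg : forall n, I n -> int).
Context (d : forall n, cfmx A (I n.+1) (I n)).

Let twist (n : nat) {J L : choiceType} (phi : cfmx A J L) : cfmx A J L :=
  cfmx_map (iter n tau) phi.

(** The morphism written c^n_l is [c n l l'] with [l' = l + 2n - 1]; the target
    index is a separate argument so that composable morphisms have matching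
    types, and [c] is unconstrained (and unused) at other values of [l'].
    Matrices with source or target index [l < 0] have no column or no row, so
    that c^n_l = 0 for [l < 0] and c^0_0 = d_0 = 0 hold automatically. *)
Record homotopy_family
    (c : nat -> forall l l' : int, cfmx A (ext_basis I l) (ext_basis I l')) :
    Prop := HomotopyFamily {
  hf_hom : forall (n : nat) (l : int), (1 <= n)%N ->
    cfmx_hom (ext_deg deg (l := l)) (ext_deg deg (l := l + n.*2%:Z - 1))
      (n * m)%N%:Z (c n l (l + n.*2%:Z - 1));
  hf_eq0 : forall (l : nat) (x : I l.+1), c 0%N l.+1%:Z l%:Z x = d x;
  hf_eq1 : forall (l : int) (x : ext_basis I l), 0 <= l ->
    cfmx_mul (c 1%N (l - 1) l) (twist 1 (c 0%N l (l - 1))) x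
      + cfmx_mul (c 0%N (l + 1) l) (c 1%N l (l + 1)) x
    = cfmx_scalar f x;
  hf_eq2 : forall (n : nat) (l : int) (x : ext_basis I l), (2 <= n)%N -> 0 <= l ->
    \sum_(i < n.+1)
      cfmx_mul (c i (l + (n - i).*2%:Z - 1) (l + n.*2%:Z - 2))
               (twist i (c (n - i)%N l (l + (n - i).*2%:Z - 1))) x
    = 0 }.

Context (c : nat -> forall l l' : int, cfmx A (ext_basis I l) (ext_basis I l')).
Context {B : cgAlg k} (pi : A -> B).

(** The basis of [T_i]: the element [b, x] lies in the summand
    [P_(i-2b)(-bm) (x)_A B], where [P (x)_A B] is the free [B]-module on the
    basis of [P], and [phi (x)_A B] is the image of the matrix [phi] in [B]. *)
Definition T_basis (i : nat) : choiceType :=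
  {b : 'I_(i./2).+1 & I (i - b.*2)%N}.

Definition T_deg (i : nat) (t : T_basis i) : int :=
  deg (tagged t) + (tag t * m)%N%:Z.

Definition T_incl (i : nat) (a : 'I_(i./2).+1) : cfmx B (I (i - a.*2)%N) (T_basis i) :=
  fun y => << Tagged (fun b : 'I_(i./2).+1 => I (i - b.*2)%N : Type) y >>.

Definition T_diff (i : nat) : cfmx B (T_basis i.+1) (T_basis i) :=
  fun t => let b := tag t in
    \sum_(a < (i./2).+1 | (a <= b)%N)
      cfmx_mul (T_incl (a := a))
        (cfmx_map pi
          (twist a (@c (b - a)%N (i.+1 - b.*2)%N%:Z (i - a.*2)%N%:Z)))
        (tagged t).

Definition T_mod (i : nat) : grMod B := free_mod B (@T_deg i).

(** [e] lists the values on the basis of [P_0] of the augmentation; the only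
    summand of [T_0] is [P_0 (x)_A B]. *)
Definition T_aug (e : I 0%N -> triv_mod A) : T_basis 0%N -> triv_mod B :=
  fun t => (e (tagged t) : k).

End Construction.
Arguments T_diff {k A} tau {I} c {B} pi i.
Arguments T_mod {k} m {I} deg B i.
Arguments T_aug {k A I} B e.

(* Main.v *)
(** Lift the differential of [T] to [D = (tau^a . c^(b-a))_(a,b)] on the free
    [A]-modules with the same bases, and let [shift] drop the summand [b = 0] and
    lower the index [b] of the others by one. The equations satisfied by [c] say
    exactly that [D (D x) = f (shift x)], and the twists make [shift] intertwine
    [D] and [tau . D]; exactness modulo [f] is read off from these two identities
    and the regularity of [f], see [T_diff_exact].

    For minimality, a minimal free resolution is isomorphic, one degree at a time,
    to any linear projective resolution, so the basis of [P_l] is in degree [l]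
    when [A] is Koszul. Then the entries of [c^n] have degree
    [n (m - 2) + 1 >= 1]. *)
Require Import Defs.
From HB Require Import structures.
From mathcomp Require Import all_boot all_order all_algebra.
From mathcomp Require Import finmap monalg.
From mathcomp Require Import boolp zify.

Set Implicit Arguments.
Unset Strict Implicit.
Unset Printing Implicit Defensive.

Import Order.TTheory GRing.Theory Num.Theory.
Local Open Scope ring_scope.

(** * Matrices and linear maps of free modules *)

Section LinearExtension.
Context {k : fieldType} {A : cgAlg k} {I : choiceType}.
Implicit Types (v : {malg A^c[I]}).

(** Zero coefficients may be added to the sum, so several vectors are compared over one common
    finite index set. *)
Lemma lin_extEw (M : lmodType A^c) (phi : I -> M) (D : {fset I}) v :
  (msupp v `<=` D)%fset -> lin_ext phi v = \sum_(x <- D) v@_x *: phi x.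
Proof.
move=> vD; rewrite /lin_ext (big_fset_incl _ vD) // => x _ xv.
by rewrite mcoeff_outdom // scale0r.
Qed.

Lemma lin_ext_linear (M : lmodType A^c) (phi : I -> M) : linear (lin_ext phi).
Proof.
move=> a u v; pose D := (msupp u `|` msupp v)%fset.
have uD : (msupp u `<=` D)%fset by exact: fsubsetUl.
have vD : (msupp v `<=` D)%fset by exact: fsubsetUr.
have sD : (msupp (a *: u + v) `<=` D)%fset.
  apply: fsubset_trans (msuppD_le _ _) _; rewrite fsubUset vD andbT.
  exact: fsubset_trans (msuppZ_le _ _) uD.
rewrite (lin_extEw phi sD) (lin_extEw phi uD) (lin_extEw phi vD).
rewrite scaler_sumr -big_split /=; apply: eq_bigr => x _.
by rewrite mcoeffD mcoeffZ scalerDl scalerA.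
Qed.

HB.instance Definition _ (M : lmodType A^c) (phi : I -> M) :=
  GRing.isLinear.Build A^c {malg A^c[I]} M *:%R (lin_ext phi)
    (lin_ext_linear phi).

Lemma lin_extU (M : lmodType A^c) (phi : I -> M) (a : A^c) x :
  lin_ext phi << a *g x >> = a *: phi x.
Proof.
rewrite (lin_extEw phi (msuppU_le (k := x) (x := a))) big_seq_fset1.
by rewrite mcoeffUU.
Qed.

Lemma lin_extU1 (M : lmodType A^c) (phi : I -> M) x :
  lin_ext phi << (1 : A^c) *g x >> = phi x.
Proof. by rewrite lin_extU scale1r. Qed.

Lemma malgU_scale (a : A^c) (x : I) : << a *g x >> = a *: << (1 : A^c) *g x >>.
Proof.
by apply/malgP => y; rewrite mcoeffZ !mcoeffU; case: eqP; rewrite ?mulr1 ?mulr0.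
Qed.

Lemma linear_lin_ext (M : lmodType A^c) (h : {linear {malg A^c[I]} -> M}) v :
  h v = lin_ext (fun x => h << (1 : A^c) *g x >>) v.
Proof.
rewrite [in LHS](monalgE v) linear_sum /lin_ext; apply: eq_bigr => x _.
by rewrite [in LHS]malgU_scale linearZ_LR.
Qed.

Lemma eq_lin_ext (M : lmodType A^c) (phi psi : I -> M) :
  phi =1 psi -> lin_ext phi =1 lin_ext psi.
Proof. by move=> e v; apply: eq_bigr => x _; rewrite e. Qed.

Lemma linear_lin_ext_comp (M N : lmodType A^c) (h : {linear M -> N})
    (phi : I -> M) v : h (lin_ext phi v) = lin_ext (fun x => h (phi x)) v.
Proof. by rewrite /lin_ext linear_sum; apply: eq_bigr => x _; rewrite linearZ. Qed.

(** Scaling multiplies entries on the right, the matrix [f I] on the left; so the latter is a module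
    map although [f] need not be central. *)
Lemma lin_ext_scalarE (f : A) v x :
  (lin_ext (cfmx_scalar f) v)@_x = f * (v@_x : A) :> A.
Proof.
rewrite [in RHS](monalgE v) /lin_ext !raddf_sum mulr_sumr; apply: eq_bigr => y _.
rewrite /= mcoeffZ !mcoeffU; case: eqP => _; rewrite ?mulr1n ?mulr0n //.
by rewrite [RHS]mulr0 [LHS]mulr0.
Qed.

Lemma lin_ext_scalar_eq0 (f : A) v : regular_elt f ->
  lin_ext (cfmx_scalar f) v = 0 -> v = 0.
Proof.
move=> fr fv; apply/malgP => x; rewrite mcoeff0; apply: fr; right.
by rewrite -lin_ext_scalarE fv mcoeff0.
Qed.

Lemma lin_ext_void (M : lmodType A^c) (phi : I -> M) v :
  (I -> False) -> lin_ext phi v = 0.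
Proof. by move=> I0; rewrite /lin_ext big1 // => x; case: (I0 x). Qed.

End LinearExtension.

(** * Change of coefficients along a ring morphism *)

Section CoefficientwiseMap.
Context {k : fieldType} {A B : cgAlg k} {I : choiceType} (g : {rmorphism A -> B}).
Implicit Types (v : {malg A^c[I]}).

(** The columns of [cfmx_map g phi] are convertible to [malg_map g] of those of [phi]; a separate
    name carries the additive structure. *)
Definition malg_map v : {malg B^c[I]} := [malg x in msupp v => (g v@_x : B^c)].

Lemma malg_mapE v x : (malg_map v)@_x = g (v@_x : A) :> B.
Proof.
rewrite mcoeffE; case: ifP => // /negbT xv.
by rewrite mcoeff_outdom // rmorph0.
Qed.

Lemma malg_map_zmod_morphism : zmod_morphism malg_map.
Proof.
by move=> u v; apply/malgP => x; rewrite mcoeffB !malg_mapE mcoeffB rmorphB.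
Qed.

HB.instance Definition _ :=
  GRing.isZmodMorphism.Build {malg A^c[I]} {malg B^c[I]} malg_map
    malg_map_zmod_morphism.

Lemma malg_mapZ (a : A) v :
  malg_map ((a : A^c) *: v) = ((g a : B) : B^c) *: malg_map v.
Proof.
apply/malgP => x; rewrite mcoeffZ !malg_mapE mcoeffZ.
exact: (rmorphM g (v@_x : A) a).
Qed.

Lemma malg_mapU (a : A) (x : I) :
  malg_map << (a : A^c) *g x >> = << (g a : B^c) *g x >>.
Proof.
apply/malgP => y; rewrite malg_mapE !mcoeffU; case: eqP => // _.
by rewrite mulr0n rmorph0.
Qed.

Lemma malg_mapU1 (x : I) : malg_map << (1 : A^c) *g x >> = << (1 : B^c) *g x >>.
Proof. by rewrite malg_mapU rmorph1. Qed.

Lemma msupp_malg_map v : (msupp (malg_map v) `<=` msupp v)%fset.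
Proof.
apply/fsubsetP => x; rewrite -!mcoeff_neq0 malg_mapE; apply: contraNN => /eqP ->.
by rewrite rmorph0.
Qed.

Lemma lin_ext_malg_map (M : lmodType A^c) (N : lmodType B^c)
    (h : {additive M -> N}) (phi : I -> M) v :
  (forall (a : A) x, h ((a : A^c) *: x) = (g a : B^c) *: h x) ->
  h (lin_ext phi v) = lin_ext (fun x => h (phi x)) (malg_map v).
Proof.
move=> hZ; rewrite (lin_extEw _ (msupp_malg_map v)) /lin_ext raddf_sum.
by apply: eq_bigr => x _; rewrite hZ malg_mapE.
Qed.

End CoefficientwiseMap.

Lemma malg_map_lin_ext (k : fieldType) (A B : cgAlg k) (I J : choiceType)
    (g : {rmorphism A -> B}) (phi : cfmx A I J) (v : {malg A^c[I]}) :
  malg_map g (lin_ext phi v) = lin_ext (cfmx_map g phi) (malg_map g v).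
Proof. by apply: lin_ext_malg_map => a x; exact: malg_mapZ. Qed.

(** * Minimal free resolutions over Koszul algebras *)

Section Components.
Context {M : zmodType} {G : int -> M -> Prop} (gG : is_grading G).
Implicit Types (x y : M) (n : int).

Let gcomp_subproof x : exists c : int -> M, exists S : seq int,
  [/\ uniq S, forall i, G i (c i), forall i, i \notin S -> c i = 0
    & x = \sum_(i <- S) c i].
Proof. by have [S [c H]] := grading_span gG x; exists c, S. Qed.

Definition gcomp n x : M := sval (cid (gcomp_subproof x)) n.

Lemma sum_family_sub (S T : seq int) (c : int -> M) : uniq S -> uniq T ->
  {subset S <= T} -> (forall i, i \notin S -> c i = 0) ->
  \sum_(i <- S) c i = \sum_(i <- T) c i.
Proof.
move=> uS uT ST c0; rewrite [RHS](bigID (mem S)) /= [X in _ + X]big1 ?addr0 //.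
rewrite -[RHS]big_filter; apply: perm_big; apply: uniq_perm => //.
  exact: filter_uniq.
by move=> i; rewrite mem_filter andb_idr // => /ST.
Qed.

(** Two decompositions, written over the union of their index lists, differ by a family with zero
    sum, which vanishes by [grading_free]. *)
Lemma gcomp_unique (S : seq int) (c : int -> M) n x : uniq S ->
  (forall i, G i (c i)) -> (forall i, i \notin S -> c i = 0) ->
  x = \sum_(i <- S) c i -> gcomp n x = c n.
Proof.
move=> uS Gc c0 xE; rewrite /gcomp; case: cid => c' [S' [uS' Gc' c'0 xE']] /=.
pose T := undup (S ++ S').
have [nT | nT] := boolP (n \in T); last first.
  move: nT; rewrite mem_undup mem_cat negb_or => /andP[nS nS'].
  by rewrite c0 // c'0.
apply/eqP; rewrite -subr_eq0; apply/eqP.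
apply: (grading_free gG (S := T) (c := fun i => c' i - c i)) => //.
- exact: undup_uniq.
- by move=> i; exact: gradingB.
- have ST : {subset S <= T} by move=> i iS; rewrite mem_undup mem_cat iS.
  have S'T : {subset S' <= T} by move=> i iS; rewrite mem_undup mem_cat iS orbT.
  rewrite sumrB -(sum_family_sub uS _ ST c0) ?undup_uniq //.
  by rewrite -(sum_family_sub uS' _ S'T c'0) ?undup_uniq // -xE -xE' subrr.
Qed.

Lemma gcomp_family x : exists S : seq int,
  [/\ uniq S, forall i, i \notin S -> gcomp i x = 0
    & x = \sum_(i <- S) gcomp i x].
Proof. by rewrite /gcomp; case: cid => c /= [S [uS _ c0 xE]]; exists S. Qed.

Lemma gcomp_gr n x : G n (gcomp n x).
Proof. by rewrite /gcomp; case: cid => c /= [S []]. Qed.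

Lemma gcomp_homog n i x : G n x -> gcomp i x = if i == n then x else 0.
Proof.
move=> Gx; pose c i := if i == n then x else 0.
apply: (gcomp_unique (S := [:: n]) (c := c)); rewrite /c //.
- by move=> j; case: eqP => [-> // | _]; exact: grading0 gG _.
- by move=> j; rewrite inE => /negbTE ->.
- by rewrite big_seq1 eqxx.
Qed.

Lemma gcompD n x y : gcomp n (x + y) = gcomp n x + gcomp n y.
Proof.
have [S [uS S0 xE]] := gcomp_family x; have [S' [uS' S'0 yE]] := gcomp_family y.
pose T := undup (S ++ S').
have ST : {subset S <= T} by move=> i iS; rewrite mem_undup mem_cat iS.
have S'T : {subset S' <= T} by move=> i iS; rewrite mem_undup mem_cat iS orbT.
apply: (gcomp_unique (S := T) (c := fun i => gcomp i x + gcomp i y)).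
- exact: undup_uniq.
- by move=> i; apply: (gradingD gG); exact: gcomp_gr.
- move=> i; rewrite mem_undup mem_cat negb_or => /andP[iS iS'].
  by rewrite S0 // S'0 // addr0.
- rewrite big_split /= -(sum_family_sub uS _ ST S0) ?undup_uniq //.
  by rewrite -(sum_family_sub uS' _ S'T S'0) ?undup_uniq // -xE -yE.
Qed.

Lemma gcomp0 n : gcomp n 0 = 0.
Proof. by rewrite (gcomp_homog n (grading0 gG n)) eqxx. Qed.

End Components.

Section GradedHomomorphisms.
Context {k : fieldType} {A : cgAlg k}.
Implicit Types (M N : grMod A).

Definition mcomp M n (x : M) : M := gcomp (grm_grading M) n x.
Definition acomp n (a : A) : A := gcomp (cga_grading A) n a.

Lemma ghom_linear M N (h : M -> N) : ghom h ->
  exists h' : {linear M -> N}, h = h' :> (M -> N).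
Proof.
case=> hl _.
by exists (HB.pack_for {linear M -> N} h (GRing.isLinear.Build _ _ _ _ h hl)).
Qed.

Lemma mcomp_ghom M N (h : M -> N) n x : ghom h -> mcomp n (h x) = h (mcomp n x).
Proof.
move=> hh; have [S [uS S0 xE]] := gcomp_family (grm_grading M) x.
case: (hh) => _ hG; have [h' hE] := ghom_linear hh.
apply: (gcomp_unique _ (S := S) (c := fun i => h (mcomp i x))) => //.
- by move=> i; apply: hG; exact: gcomp_gr.
- by move=> i /S0 i0; rewrite /mcomp i0 hE linear0.
- by rewrite {1}xE hE linear_sum.
Qed.

Lemma mcomp_act M i n (x : M) (a : A) : grm_gr i x ->
  mcomp n ((a : A^c) *: x) = (acomp (n - i) a : A^c) *: x.
Proof.
move=> Gx; have [S [uS S0 aE]] := gcomp_family (cga_grading A) a.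
apply: (gcomp_unique _ (S := [seq j + i | j <- S])
          (c := fun t => (acomp (t - i) a : A^c) *: x)).
- by rewrite map_inj_uniq //; exact: addIr.
- move=> j; rewrite -[j in grm_gr j](subrK i) addrC.
  by apply: grm_act => //; exact: gcomp_gr.
- move=> j jS; rewrite /acomp S0 ?scale0r //; apply: contra jS => jS.
  by apply/mapP; exists (j - i) => //; rewrite subrK.
- rewrite big_map {1}aE scaler_suml; apply: eq_bigr => j _.
  by rewrite addrK.
Qed.

Lemma acomp_aug n (a : A) : n != 0 -> aug_ideal (acomp n a).
Proof.
move=> n0; have Ga := gcomp_gr (cga_grading A) n a.
have [n1 | n1] := lerP 1 n.
  by rewrite -[acomp n a]addr0; exact: gspanD n1 Ga (gspan0 _ _).
have -> : acomp n a = 0 by apply: cga_neg Ga; lia.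
exact: gspan0.
Qed.

Lemma rspan_add M (X : M -> Prop) (D : A -> Prop) x y :
  rspan X D x -> rspan X D y -> rspan X D (x + y).
Proof.
move=> Xx Xy; elim: Xx => [|u a v Xu Da _ IH]; first by rewrite add0r.
by rewrite -addrA; exact: rspanD.
Qed.

Lemma rspan1 M (X : M -> Prop) (D : A -> Prop) x a :
  X x -> D a -> rspan X D ((a : A^c) *: x).
Proof. by move=> Xx Da; rewrite -[_ *: _]addr0; apply: rspanD => //; exact: rspan0. Qed.

(** Generators in degree [n] reach degree [t] only through coefficients of degree [t - n], which is
    nonzero; [A] vanishes in negative degrees. *)
Lemma mcomp_generated M n t (y : M) : generated_in_degree M n -> t != n ->
  rspan (fun=> True) (@aug_ideal k A) (mcomp t y).
Proof.
move=> gM tn; elim: (gM y) => [|x a z Gx _ _ IH].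
  by rewrite /mcomp gcomp0; exact: rspan0.
rewrite /mcomp gcompD -!/(mcomp _ _) (mcomp_act _ _ Gx).
by apply: rspanD => //; apply: acomp_aug; rewrite subr_eq0.
Qed.

Lemma generated_low M n t (y : M) : generated_in_degree M n -> t < n ->
  mcomp t y = 0.
Proof.
move=> gM tn; elim: (gM y) => [|x a z Gx _ _ IH]; first exact: gcomp0.
rewrite /mcomp gcompD -!/(mcomp _ _) (mcomp_act _ _ Gx) IH addr0.
have -> : acomp (t - n) a = 0; last by rewrite scale0r.
by apply: cga_neg (gcomp_gr (cga_grading A) _ a); rewrite subr_lt0.
Qed.

(** The elements of [N] are lifted one by one and the coefficients in [D] are kept. *)
Lemma rspan_lift M N (X : grMod A) (p : M -> X) (q : N -> X) (D : A -> Prop) y :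
  ghom p -> ghom q -> (forall y, exists u, p u = q y) ->
  rspan (fun=> True) D y -> exists2 u, rspan (fun=> True) D u & p u = q y.
Proof.
move=> /ghom_linear[p' ->] /ghom_linear[q' ->] pq.
elim=> [|x a z _ Da _ [u Du uE]]; first by exists 0; [exact: rspan0 | rewrite !linear0].
have [v vE] := pq x; exists ((a : A^c) *: v + u); first exact: rspanD.
by rewrite !linearP uE vE.
Qed.

End GradedHomomorphisms.

(** * Covers by graded free modules *)

Section FreeGraded.
Context {k : fieldType} {A : cgAlg k} {I : choiceType} (deg : I -> int).

Definition basis (x : I) : free_mod A deg := << (1 : A^c) *g x >>.

Lemma basis_gr x : grm_gr (deg x) (basis x).
Proof.
move=> y; rewrite mcoeffU; case: eqP => [<- | _]; last first.
  exact: (grading0 (cga_grading A)).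
by rewrite subrr mulr1n; apply/cga_deg0; exists 1; rewrite scale1r.
Qed.

Lemma lin_ext_ghom (M : grMod A) (phi : I -> M) :
  (forall x, grm_gr (deg x) (phi x)) -> ghom (M := free_mod A deg) (lin_ext phi).
Proof.
move=> Gphi; split; first exact: lin_ext_linear.
move=> n v Gv; rewrite /lin_ext; elim: (enum_fset _) => [|x s IH].
  by rewrite big_nil; exact: (grading0 (grm_grading M)).
rewrite big_cons; apply: (gradingD (grm_grading M)) => //.
by rewrite -[n](subrK (deg x)) addrC; apply: grm_act; [exact: Gphi | exact: Gv].
Qed.

Lemma ghom_basis_gr (M : grMod A) (phi : I -> M) x :
  ghom (M := free_mod A deg) (lin_ext phi) -> grm_gr (deg x) (phi x).
Proof.
move=> [_ hG]; rewrite -[phi x]scale1r -lin_extU; apply: hG; exact: basis_gr.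
Qed.

(** The entries of [u . a] are left multiples of [a], which stay in the ideal; conversely [v] is the
    sum of basis elements times its entries. *)
Lemma rspan_aug_coeff (v : free_mod A deg) :
  rspan (fun=> True) (@aug_ideal k A) v <-> forall x, aug_ideal (v@_x : A).
Proof.
split.
  elim=> [|u a w _ Da _ IH] x; first by rewrite mcoeff0; exact: gspan0.
  rewrite mcoeffD mcoeffZ; apply: gspan_add (IH x); exact: aug_ideal_mull Da.
move=> av; rewrite [v](monalgE (v : {malg A^c[I]})).
elim: (enum_fset _) => [|x s IH]; first by rewrite big_nil; exact: rspan0.
rewrite big_cons malgU_scale; apply: rspan_add => //; exact: rspan1.
Qed.

Lemma basis_not_rad x : ~ rspan (fun=> True) (@aug_ideal k A) (basis x).
Proof.
move=> /rspan_aug_coeff/(_ x); rewrite mcoeffUU => aug_1.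
have /aug_ideal_scalar/eqP : aug_ideal ((1 : k)%:A : A) by rewrite scale1r.
by rewrite oner_eq0.
Qed.

(** The entries of [u] are scalars by degree, and [A_{>=1}] contains no nonzero scalar. *)
Lemma rad_degree0 n (u : free_mod A deg) : (forall x, deg x = n) ->
  grm_gr n u -> rspan (fun=> True) (@aug_ideal k A) u -> u = 0.
Proof.
move=> degn Gu /rspan_aug_coeff au; apply/malgP => x; rewrite mcoeff0.
have := Gu x; rewrite degn subrr => /cga_deg0[c uE].
by have := au x; rewrite uE => /aug_ideal_scalar ->; rewrite scale0r.
Qed.

(** A map of covers [phi] over [X] is bijective in degree [n], where both sides
    are generated; it splits because [Q] is projective, hence it is bijective. *)
Lemma projective_cover_iso n (Q X : grMod A) (p : free_mod A deg -> X) (q : Q -> X) :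
  ghom p -> ghom q -> gprojective Q -> generated_in_degree Q n ->
  (forall u, exists y, q y = p u) -> (forall y, exists u, p u = q y) ->
  (forall u, p u = 0 -> rspan (fun=> True) (@aug_ideal k A) u) ->
  (forall y, grm_gr n y -> q y = 0 -> y = 0) ->
  (forall x, deg x = n) /\ exists phi : free_mod A deg -> Q,
    [/\ ghom phi, forall u, phi u = 0 -> u = 0, forall y, exists u, phi u = y
      & forall u, q (phi u) = p u].
Proof.
move=> hp hq projQ genQ imp imq kerp kerq.
have [p' pE] := ghom_linear hp; have [q' qE] := ghom_linear hq.
(* A preimage of [p (basis x)] becomes homogeneous on passing to its component of degree [deg x]. *)
have lift x : exists2 y, grm_gr (deg x) y & q y = p (basis x).
  have [y yE] := imp (basis x); exists (mcomp (deg x) y); first exact: gcomp_gr.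
  rewrite -(mcomp_ghom _ _ hq) yE (mcomp_ghom _ _ hp).
  by rewrite /mcomp (gcomp_homog _ _ (basis_gr x)) eqxx.
(* Otherwise [y] lies in [Q . A_{>=1}], so [p (basis x) = p u] with [u] in the radical; as [ker p]
   is in the radical too, so is [basis x]. *)
have degn x : deg x = n.
  apply/eqP; case: (eqVneq (deg x) n) => // xn; exfalso.
  have [y Gy yE] := lift x.
  have ry : rspan (fun=> True) (@aug_ideal k A) y.
    have := mcomp_generated y genQ xn.
    by rewrite /mcomp (gcomp_homog _ _ Gy) eqxx.
  have [u ru uE] := rspan_lift hp hq imq ry.
  apply: (@basis_not_rad x); rewrite -[basis x](subrK u); apply: rspan_add ru.
  by apply: kerp; rewrite pE linearB -pE uE yE subrr.
split=> //.
have [y0 y0P] := boolp.choice (fun x => let: ex_intro2 y Gy yE := lift x in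
  ex_intro (fun y => grm_gr (deg x) y /\ q y = p (basis x)) y (conj Gy yE)).
pose phi := lin_ext y0 : free_mod A deg -> Q.
have hphi : ghom phi by apply: lin_ext_ghom => x; case: (y0P x).
have qphi u : q (phi u) = p u.
  rewrite qE pE [LHS](linear_lin_ext_comp q') [RHS](linear_lin_ext p').
  apply: eq_lin_ext => x; case: (y0P x) => _; by rewrite qE pE.
(* Surjectivity in degree [n] comes from injectivity of [q] there; generation in degree [n] then
   gives all of [Q]. *)
have phi_surj_n y : grm_gr n y -> exists u, phi u = y.
  move=> Gy; have [u uE] := imq y; exists (mcomp n u); apply/eqP.
  rewrite eq_sym -subr_eq0; apply/eqP/kerq.
    apply: (gradingB (grm_grading Q)) => //; apply: (proj2 hphi); exact: gcomp_gr.
  rewrite qE linearB -!qE qphi -(mcomp_ghom _ _ hp) uE (mcomp_ghom _ _ hq).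
  by rewrite /mcomp (gcomp_homog _ _ Gy) eqxx subrr.
have phi_surj y : exists u, phi u = y.
  elim: (genQ y) => [|x a z Gx _ _ [u <-]]; first by exists 0; rewrite /phi linear0.
  have [v <-] := phi_surj_n x Gx; exists ((a : A^c) *: v + u).
  by rewrite /phi linearP.
(* Projectivity of [Q] splits [phi]. The section [psi] is also a left inverse: on basis elements,
   [psi (phi u) - u] has degree [n] and is killed by [p]. *)
have [psi hpsi psiK] := projQ _ _ phi id hphi phi_surj
  (conj (fun _ _ _ => erefl) (fun _ _ h => h)).
have [psi' psiE] := ghom_linear hpsi.
have phiK u : psi (phi u) = u.
  have [phi' phiE] := ghom_linear hphi.
  rewrite psiE phiE [LHS](linear_lin_ext (psi' \o phi')) [RHS](linear_lin_ext idfun).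
  apply: eq_lin_ext => x; rewrite /= -psiE -phiE -/(basis x).
  apply/eqP; rewrite -subr_eq0; apply/eqP; apply: (rad_degree0 degn).
    apply: (gradingB (grm_grading (free_mod A deg))); last first.
      by rewrite -(degn x); exact: basis_gr.
    apply: (proj2 hpsi); apply: (proj2 hphi); rewrite -(degn x); exact: basis_gr.
  apply: kerp; rewrite pE linearB -!pE -!qphi psiK subrr //.
exists phi; split=> // u u0; by rewrite -(phiK u) u0 psiE linear0.
Qed.

End FreeGraded.

(** Induction along both resolutions: the isomorphism [phi] is built together with the matching of
    the images of [d n] and [dQ n], so that the next two terms cover the same submodule of [Q n]. *)
Lemma koszul_deg (k : fieldType) (A : cgAlg k) (I : nat -> choiceType)
    (deg : forall n, I n -> int) (d : forall n, cfmx A (I n.+1) (I n))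
    (e : I 0%N -> triv_mod A) :
  gminimal_resolution (N := triv_mod A)
    (P := fun n => free_mod A (@deg n)) (fun n => lin_ext (@d n)) (lin_ext e) ->
  koszul A -> forall n (x : I n), deg n x = n%:Z.
Proof.
move=> [[he hd e_surj e0 d0] dmin].
move=> [Q [dQ [eps [[heps hdQ eps_surj eps0 dQ0] projQ]]]] n.
suff [] : (forall x, deg n x = n%:Z) /\ exists phi : free_mod A (@deg n) -> Q n,
    [/\ ghom phi, forall u, phi u = 0 -> u = 0, forall y, exists u, phi u = y
      & forall u, (exists y, u = lin_ext (d n) y) <-> exists y, phi u = dQ n y] by [].
(* The image of [dQ i] has nothing in degree [i], because [Q i.+1] starts in degree [i + 1]. *)
have low i y : grm_gr i%:Z y -> (exists z, y = dQ i z) -> y = 0.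
  move=> Gy [z zE]; have := mcomp_ghom i%:Z z (hdQ i).
  rewrite -zE /mcomp (gcomp_homog _ _ Gy) eqxx => ->.
  rewrite -/(mcomp _ _) (generated_low z (proj2 (projQ i.+1))) ?ltz_nat //.
  by have [h ->] := ghom_linear (hdQ i); rewrite linear0.
elim: n => [|n [degn [phi [hphi phi_inj phi_surj phi_im]]]].
  have [| | | |degn [phi [hphi phi_inj phi_surj qphi]]] :=
    projective_cover_iso he heps (proj1 (projQ 0%N)) (proj2 (projQ 0%N)).
  - by move=> u; exact: eps_surj.
  - by move=> y; exact: e_surj.
  - by move=> u /e0[y ->]; exact: dmin.
  - by move=> y Gy /eps0 y0; exact: low y0.
  split=> //; exists phi; split=> // u.
  by rewrite -e0 -qphi eps0.
have hp : ghom (M := free_mod A (@deg n.+1)) (fun u => phi (lin_ext (d n) u)).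
  split; last by move=> i u Gu; apply: (proj2 hphi); apply: (proj2 (hd n)).
  by move=> a u v; rewrite linearP; have [h ->] := ghom_linear hphi; rewrite linearP.
have [| | | |degn' [phi' [hphi' phi'_inj phi'_surj qphi']]] :=
    projective_cover_iso hp (hdQ n) (proj1 (projQ n.+1)) (proj2 (projQ n.+1)).
- move=> u; have /phi_im[y] : exists y, lin_ext (d n) u = lin_ext (d n) y.
    by exists u.
  by exists y.
- move=> y; have [v vE] := phi_surj (dQ n y).
  have /phi_im[u uE] : exists y, phi v = dQ n y by exists y.
  by exists u; rewrite -uE.
- by move=> u /phi_inj/d0[y ->]; exact: dmin.
- by move=> y Gy /dQ0 y0; exact: low y0.
split=> //; exists phi'; split=> // u.
rewrite -d0 -dQ0 qphi'; split=> [-> | /phi_inj //].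
by have [h ->] := ghom_linear hphi; rewrite linear0.
Qed.

(** * The lift of the complex to [A] *)

Section IteratedMorphism.
Context {k : fieldType} {A : cgAlg k} (tau : {rmorphism A -> A}) (n : nat).

Fact iter_zmod_morphism : zmod_morphism (iter n tau).
Proof. by elim: n => // j IH x y; rewrite !iterS IH rmorphB. Qed.

Fact iter_monoid_morphism : monoid_morphism (iter n tau).
Proof.
split; first by elim: n => //= j ->; rewrite rmorph1.
by elim: n => // j IH x y; rewrite !iterS IH rmorphM.
Qed.

HB.instance Definition _ :=
  GRing.isZmodMorphism.Build A A (iter n tau) iter_zmod_morphism.
HB.instance Definition _ :=
  GRing.isMonoidMorphism.Build A A (iter n tau) iter_monoid_morphism.

End IteratedMorphism.

Lemma malg_map_comp (k : fieldType) (A B C : cgAlg k) (I : choiceType)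
    (g : {rmorphism A -> B}) (h : {rmorphism B -> C}) (gh : {rmorphism A -> C})
    (v : {malg A^c[I]}) :
  (forall a, gh a = h (g a)) -> malg_map gh v = malg_map h (malg_map g v).
Proof. by move=> E; apply/malgP => x; rewrite !malg_mapE E. Qed.

Lemma malg_map_id (k : fieldType) (A : cgAlg k) (I : choiceType)
    (g : {rmorphism A -> A}) (v : {malg A^c[I]}) :
  (forall a, g a = a) -> malg_map g v = v.
Proof. by move=> E; apply/malgP => x; rewrite !malg_mapE E. Qed.

(** * Reduction modulo [f] *)

Section QuotientModules.
Context {k : fieldType} {A B : cgAlg k} (f : A) (pi : {lrmorphism A -> B}).
Context (tau : {rmorphism A -> A}) (ftau : forall a, a * f = f * tau a).
Context (norm_f : forall a, exists b, f * a = b * f).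
Context (B_quot : graded_quotient f pi).

Lemma pi_f : pi f = 0.
Proof.
case: B_quot => _ _ /(_ f)[_ ->] //; exists [:: (1, 1)].
by rewrite big_seq1 /= mul1r mulr1.
Qed.

(** Normality moves [f] to the front of every term [a * f * b], so the two-sided ideal is [f A]. *)
Lemma pi_eq0 a : pi a = 0 -> exists b, a = f * b.
Proof.
case: B_quot => _ _ /(_ a)[piE _] /piE[s ->].
elim: s => [|p s [b IH]]; first by exists 0; rewrite big_nil mulr0.
have [q qE] := norm_f p.2; exists (tau (p.1 * q) + b).
by rewrite big_cons IH mulrDr -ftau -!mulrA qE.
Qed.

Lemma malg_map_pi_surj (I : choiceType) (w : {malg B^c[I]}) :
  exists v : {malg A^c[I]}, malg_map pi v = w.
Proof.
case: B_quot => piS _ _; have [pre preE] := boolp.choice piS.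
exists [malg x in msupp w => (pre w@_x : A^c)].
apply/malgP => x; rewrite malg_mapE mcoeffE; case: ifP => [_ | /negbT xw].
  exact: preE.
by rewrite rmorph0 mcoeff_outdom.
Qed.

Lemma malg_map_pi_eq0 (I : choiceType) (v : {malg A^c[I]}) :
  malg_map pi v = 0 -> exists y, v = lin_ext (cfmx_scalar f) y.
Proof.
move=> v0; have /boolp.choice[q qE] x : exists b : A, v@_x = f * b :> A.
  by apply: pi_eq0; rewrite -malg_mapE v0 mcoeff0.
exists [malg x in msupp v => (q x : A^c)].
apply/malgP => x; rewrite lin_ext_scalarE mcoeffE; case: ifP => [_ | /negbT xv].
  exact: qE.
by rewrite [RHS]mulr0 mcoeff_outdom.
Qed.

Lemma malg_map_pi_scalar (I : choiceType) (v : {malg A^c[I]}) :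
  malg_map pi (lin_ext (cfmx_scalar f) v) = 0.
Proof.
by apply/malgP => x; rewrite malg_mapE lin_ext_scalarE rmorphM /= pi_f mul0r mcoeff0.
Qed.

Lemma aug_ideal_pi a : aug_ideal a -> aug_ideal (pi a).
Proof.
elim=> [|i x y i1 Gx _ IH]; first by rewrite rmorph0; exact: gspan0.
rewrite rmorphD; apply: (gspanD i1 _ IH); case: B_quot => _ /(_ i (pi x)) E _.
by apply/E; exists x.
Qed.

Lemma aug_pi a : aug (pi a) = aug a.
Proof.
apply: aug_unique; have -> : (aug a)%:A = pi (aug a)%:A :> B.
  by rewrite linearZ rmorph1.
by rewrite -rmorphB; exact: aug_ideal_pi (augP a).
Qed.

(** Both trivial modules are carried by [k], and the identity between them is semilinear along [pi]
    because [pi] preserves the augmentation. *)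
Lemma lin_ext_triv_pi (J : choiceType) (e : J -> k) (v : {malg A^c[J]}) :
  lin_ext (M := triv_mod B) e (malg_map pi v)
    = lin_ext (M := triv_mod A) e v :> k.
Proof.
pose h := HB.pack_for {additive triv_mod A -> triv_mod B}
  (id : triv_mod A -> triv_mod B)
  (GRing.isZmodMorphism.Build (triv_mod A) (triv_mod B)
     (id : triv_mod A -> triv_mod B) (fun _ _ => erefl)).
rewrite -[RHS]/(h (lin_ext (M := triv_mod A) e v)).
rewrite (@lin_ext_malg_map _ _ _ _ pi (triv_mod A) (triv_mod B) h) //.
move=> a x; rewrite -[LHS]/(aug a * (x : k)) -[RHS]/(aug (pi a) * (x : k)).
by rewrite aug_pi.
Qed.

(** Moving [f] to the left past an entry [a] turns [a] into [tau a]; this is the origin of the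
    twists. *)
Lemma lin_ext_scalar_comm (I J : choiceType) (phi : cfmx A I J) v :
  lin_ext phi (lin_ext (cfmx_scalar f) v)
    = lin_ext (cfmx_scalar f) (lin_ext (cfmx_map tau phi) v).
Proof.
rewrite !linear_lin_ext_comp; apply: eq_lin_ext => x.
rewrite {1}/cfmx_scalar /= lin_extU; apply/malgP => y.
by rewrite mcoeffZ lin_ext_scalarE malg_mapE; exact: ftau.
Qed.

End QuotientModules.

Section Construction.
Context {k : fieldType} {A : cgAlg k} (m : nat) (f : A) (tau : {rmorphism A -> A}).
Context (I : nat -> choiceType) (deg : forall n, I n -> int).
Context (d : forall n, cfmx A (I n.+1) (I n)).
Context (c : nat -> forall l l' : int, cfmx A (ext_basis I l) (ext_basis I l')).
Context (c_fam : homotopy_family m f tau deg d c).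
Context (f_regular : regular_elt f) (tau_f : tau f = f).
Context (ftau : forall a, a * f = f * tau a).
Context (dd0 : forall i (x : {malg A^c[I i.+1]}),
  lin_ext (@d i) x = 0 <-> exists y, x = lin_ext (@d i.+1) y).

(** Restriction to natural indices, where [ext_basis] computes to [I]. *)
Definition cn n l l' : cfmx A (I l) (I l') := @c n l%:Z l'%:Z.
Arguments cn n l l' _ : clear implicits.

(** The [r]-th summand of [hf_eq1] and [hf_eq2], for [l + 2 n = L + 2]. The
    intermediate index [L + 1 - 2 r] is negative only for [l = 0] and [r = n];
    that summand vanishes, and sums over [r] leave it out since the subtraction
    here is truncated. *)
Definition homotopy_term n l L r (x : I l) : {malg A^c[I L]} :=
  lin_ext (cn r (L.+1 - r.*2) L)
    (malg_map (iter r tau) (cn (n - r) l (L.+1 - r.*2) x)).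
Arguments homotopy_term n {l} L r x.

Lemma lin_ext_neg (l : int) (M : lmodType A^c) (phi : ext_basis I l -> M) v :
  l < 0 -> lin_ext phi v = 0.
Proof. by case: l phi v => // l phi v _; apply: lin_ext_void => -[]. Qed.

Lemma lin_ext_comp0 i (x : {malg A^c[I i.+2]}) :
  lin_ext (@d i) (lin_ext (@d i.+1) x) = 0.
Proof. by apply/dd0; exists x. Qed.

Lemma cn0E l : cn 0 l.+1 l =1 @d l.
Proof. exact: (hf_eq0 c_fam). Qed.

(** For [n = 0] the sum is [d (d x)]; for [n >= 2] it is that of [hf_eq2], with any summand of
    negative intermediate index left out. *)
Lemma homotopy_sum0 n l L (x : I l) : n != 1%N -> (l + n.*2 = L.+2)%N ->
  \sum_(r < n.+1 | (r.*2 <= L.+1)%N) homotopy_term n L r x = 0.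
Proof.
case: n => [|[|n]] // _ lL.
  rewrite addn0 in lL; subst l; rewrite big_mkcond big_ord1 /= /homotopy_term /=.
  rewrite malg_map_id // (eq_lin_ext (cn0E (l := L))) -(lin_ext_comp0 << 1 *g x >>).
  by rewrite lin_extU1 cn0E.
have lLZ : l%:Z + n.+2.*2%:Z - 2 = L%:Z by lia.
have := hf_eq2 c_fam (n := n.+2) (l := l%:Z) x isT isT.
rewrite lLZ => E; rewrite -[RHS]E big_mkcond; apply: eq_bigr => r _.
rewrite /homotopy_term /cn /cfmx_mul.
have rn := ltn_ord r.
case: ifP => [rL | /negbT rL].
  have -> : l%:Z + (n.+2 - r).*2%:Z - 1 = (L.+1 - r.*2)%N%:Z by lia.
  by [].
by rewrite lin_ext_neg //; lia.
Qed.

Lemma homotopy_sum1 L (x : I L) :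
  \sum_(r < 2 | (r.*2 <= L.+1)%N) homotopy_term 1 L r x = cfmx_scalar f x.
Proof.
have := hf_eq1 c_fam (l := L%:Z) x isT.
have -> : L%:Z + 1 = L.+1%:Z by lia.
move=> <-; rewrite big_mkcond 2!big_ord_recl big_ord0 /= addr0.
rewrite addrC [X in _ + X](_ : _ =
  cfmx_mul (@c 0 L.+1%:Z L%:Z) (@c 1 L%:Z L.+1%:Z) x); last first.
  by rewrite /homotopy_term malg_map_id.
rewrite [X in X + _](_ : _ = cfmx_mul (@c 1 (L%:Z - 1) L%:Z)
  (cfmx_map (iter 1 tau) (@c 0 L%:Z (L%:Z - 1))) x) //.
rewrite -[bump 0 0]/1%N; case: ifP => [L1 | /negbT L1].
  by have -> : L%:Z - 1 = (L.+1 - 1.*2)%N%:Z by lia.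
by rewrite /cfmx_mul lin_ext_neg //; lia.
Qed.

(** * Summands of the lift and the index shift *)

Notation TA := (T_basis I).
(** The lifted differential is the same construction with the identity of [A] in place of [pi]. *)
Notation D i := (T_diff tau c (@idfun A) i).

Definition T_elt i b (hb : (b < (i./2).+1)%N) (x : I (i - b.*2)) : TA i :=
  Tagged (fun b : 'I_(i./2).+1 => I (i - b.*2)%N : Type) (i := Ordinal hb) x.

Lemma T_elt_irr i b (hb hb' : (b < (i./2).+1)%N) (x : I (i - b.*2)) :
  << (1 : A^c) *g T_elt hb x >> = << 1 *g T_elt hb' x >>.
Proof. by rewrite (bool_irrelevance hb hb'). Qed.

Definition shift_basis i (t : TA i.+2) : {malg A^c[TA i]} :=
  let: existT (Ordinal b hb) x := t in
  match b return (b < (i./2).+2)%N -> I (i.+2 - b.*2) -> {malg A^c[TA i]} with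
  | 0 => fun _ _ => 0
  | b'.+1 => fun hb x => << 1 *g T_elt (i := i) (b := b') hb x >>
  end hb x.

Definition unshift_basis i (t : TA i) : {malg A^c[TA i.+2]} :=
  let: existT (Ordinal b hb) x := t in << 1 *g T_elt (i := i.+2) (b := b.+1) hb x >>.

Definition shift i := lin_ext (@shift_basis i).
Definition unshift i := lin_ext (@unshift_basis i).
Definition inc i (a : 'I_(i./2).+1) : {malg A^c[I (i - a.*2)]} -> {malg A^c[TA i]} :=
  lin_ext (@T_incl k I A i a).

Lemma shift_unshift i (v : {malg A^c[TA i]}) : shift (unshift v) = v.
Proof.
rewrite /shift /unshift linear_lin_ext_comp.
rewrite [RHS](linear_lin_ext idfun); apply: eq_lin_ext => -[[b hb] x].
by rewrite /= lin_extU1.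
Qed.

Lemma shift_inc0 i (w : {malg A^c[I i.+2]}) : shift (inc (i := i.+2) (a := ord0) w) = 0.
Proof.
rewrite /shift /inc linear_lin_ext_comp /lin_ext big1 // => x _.
by rewrite /T_incl /= lin_extU1 scaler0.
Qed.

Lemma shift_inc i (a : 'I_(i./2).+1) (w : {malg A^c[I (i - a.*2)]}) :
  shift (inc (i := i.+2) (a := lift ord0 a) w) = inc w.
Proof.
rewrite /shift /inc linear_lin_ext_comp; apply: eq_lin_ext => x.
rewrite /T_incl [LHS]lin_extU1; case: a {w} x => a ha x.
by rewrite /= (T_elt_irr _ ha).
Qed.

Lemma inc_coeff i (a : 'I_(i./2).+1) w x :
  (inc w)@_(Tagged (fun b : 'I_(i./2).+1 => I (i - b.*2)%N : Type) (i := a) x) = w@_x.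
Proof.
rewrite /inc /lin_ext raddf_sum /= [in RHS](monalgE w) raddf_sum /=.
apply: eq_bigr => y _; rewrite mcoeffZ !mcoeffU eq_Tagged /=.
by case: eqP => _; rewrite ?mulr1 ?mulr0.
Qed.

Lemma inc_eq0 i (a : 'I_(i./2).+1) (w : {malg A^c[I (i - a.*2)]}) :
  inc w = 0 -> w = 0.
Proof. by move=> w0; apply/malgP => x; rewrite -inc_coeff w0 !mcoeff0. Qed.

(** Projection onto the summand [b = 0]. The index is a successor because [i.+1 - 0] computes to
    [i.+1], whereas [i - 0] is stuck for a variable [i]; index 0 is therefore treated separately
    below. *)
Definition top_basis i (t : TA i.+1) : {malg A^c[I i.+1]} :=
  let: existT (Ordinal b hb) x := t in
  match b return (b < (i.+1./2).+1)%N -> I (i.+1 - b.*2) -> {malg A^c[I i.+1]} with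
  | 0 => fun _ x => << 1 *g x >>
  | b'.+1 => fun _ _ => 0
  end hb x.

(** Splits off the summand [b = 0]; the others form a copy of the module two steps below. *)
Lemma top_shift i (v : {malg A^c[TA i.+2]}) :
  v = inc (i := i.+2) (a := ord0) (lin_ext (@top_basis i.+1) v)
      + unshift (shift v).
Proof.
rewrite /shift /unshift /inc !linear_lin_ext_comp /lin_ext -big_split /=.
rewrite [LHS]monalgE; apply: eq_bigr => t _.
rewrite -scalerDr [LHS]malgU_scale; congr (_ *: _).
case: t => -[[|b] hb] x; rewrite /= -!/(lin_ext _ _).
  by rewrite linear0 addr0 lin_extU1; exact: T_elt_irr.
by rewrite linear0 add0r lin_extU1.
Qed.

Lemma shift_eq0 i (v : {malg A^c[TA i.+2]}) :
  shift v = 0 -> exists w, v = inc (i := i.+2) (a := ord0) w.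
Proof.
move=> v0; exists (lin_ext (@top_basis i.+1) v).
by rewrite [LHS]top_shift v0 /unshift linear0 addr0.
Qed.

Lemma inc_top1 (v : {malg A^c[TA 1]}) : exists w : {malg A^c[I 1%N]},
  v = inc (i := 1) (a := ord0) w.
Proof.
exists (lin_ext (@top_basis 0) v); rewrite /inc linear_lin_ext_comp.
rewrite [LHS](linear_lin_ext idfun); apply: eq_lin_ext => -[[[|b] hb] x] //=.
by rewrite lin_extU1; exact: T_elt_irr.
Qed.

Lemma T_diffE i (b : 'I_(i.+1./2).+1) (x : I (i.+1 - b.*2)) :
  D i (Tagged (fun b : 'I_(i.+1./2).+1 => I (i.+1 - b.*2)%N : Type) x)
  = \sum_(a < (i./2).+1 | (a <= b)%N)
      inc (malg_map (iter a tau) (cn (b - a) (i.+1 - b.*2) (i - a.*2) x)).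
Proof.
apply: eq_bigr => a _; rewrite /cfmx_mul /inc; congr lin_ext.
exact: malg_map_id.
Qed.

Lemma T_diff_inc i (b : 'I_(i.+1./2).+1) w :
  lin_ext (D i) (inc (a := b) w)
  = \sum_(a < (i./2).+1 | (a <= b)%N)
      inc (lin_ext (cfmx_map (iter a tau) (cn (b - a) (i.+1 - b.*2) (i - a.*2))) w).
Proof.
rewrite /inc linear_lin_ext_comp /lin_ext.
under [RHS]eq_bigr => a _ do rewrite -!/(lin_ext _ _) linear_lin_ext_comp /lin_ext.
rewrite exchange_big /=; apply: eq_bigr => x _; rewrite -scaler_sumr; congr (_ *: _).
rewrite -/(lin_ext _ _) lin_extU1 T_diffE.
by apply: eq_bigr => a _; rewrite /inc /cfmx_map.
Qed.

Lemma shift_basis_lift i (b : 'I_(i./2).+1) (x : I (i - b.*2)) :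
  shift_basis (i := i) (existT _ (lift ord0 b) x)
  = << 1 *g Tagged (fun b : 'I_(i./2).+1 => I (i - b.*2)%N : Type) x >>.
Proof. by case: b x => b hb x; exact: T_elt_irr. Qed.

(** The component of [D] from [b + 1] to [a + 1] is that from [b] to [a], twisted once more by
    [tau]. Nothing else survives: [shift] kills the row [a = 0], and the column [b = 0] meets only
    that row. *)
Lemma shift_T_diff i (v : {malg A^c[TA i.+3]}) :
  shift (lin_ext (D i.+2) v) = lin_ext (cfmx_map tau (D i)) (shift v).
Proof.
rewrite /shift !linear_lin_ext_comp; apply: eq_lin_ext => -[b x].
rewrite T_diffE big_mkcond big_ord_recl linearD.
rewrite [X in X + _](_ : _ = 0) ?add0r; last exact: shift_inc0.
rewrite linear_sum.
have [b' bE | bE] := unliftP ord0 b; last first.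
  subst b; rewrite big1 ?linear0 // => a _.
  by rewrite leqNgt /= linear0.
subst b; rewrite -[RHS]/(lin_ext _ (shift_basis (existT _ (lift ord0 b') x))).
rewrite shift_basis_lift.
rewrite lin_extU1 /cfmx_map -/(malg_map _ _) T_diffE raddf_sum /= [RHS]big_mkcond.
apply: eq_bigr => a _.
rewrite [(lift ord0 a <= _)%N](_ : _ = (a <= b')%N) //.
case: ifP => ab; last by rewrite linear0.
transitivity (inc (malg_map (iter a.+1 tau)
    (cn (b' - a) (i.+1 - b'.*2) (i - a.*2) x))).
  exact: (shift_inc (a := a)
    (malg_map (iter a.+1 tau) (cn (b' - a) (i.+1 - b'.*2) (i - a.*2) x))).
rewrite /inc malg_map_lin_ext.
have E := @malg_map_comp _ A A A _ (iter a tau) tau (iter a.+1 tau) _ (fun _ => erefl).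
rewrite -E.
apply: eq_lin_ext => y.
rewrite /cfmx_map.
by rewrite -/(malg_map _ _) malg_mapU1.
Qed.

Lemma iter_tau_f n : iter n tau f = f.
Proof. by elim: n => //= n ->. Qed.

(** The path from [b] to [a] through [j] is indexed by [r = j - a]; the common twist [tau^a] comes
    out and leaves the homotopy sum for [b - a]. *)
Lemma T_diff_sq_component i (b : 'I_(i./2).+2) (a : 'I_(i./2).+1)
    (x : I (i.+2 - b.*2)) :
  \sum_(j < (i.+1./2).+1 | (j <= b)%N && (a <= j)%N)
     lin_ext (cfmx_map (iter a tau) (cn (j - a) (i.+1 - j.*2) (i - a.*2)))
       (malg_map (iter j tau) (cn (b - j) (i.+2 - b.*2) (i.+1 - j.*2) x))
  = malg_map (iter a tau)
      (\sum_(r < (b - a).+1 | (a <= b)%N && (r.*2 <= (i - a.*2).+1)%N)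
         homotopy_term (b - a) (i - a.*2) r x).
Proof.
have hb := ltn_ord b; have ha := ltn_ord a.
pose H j : {malg A^c[I (i - a.*2)%N]} :=
  lin_ext (cfmx_map (iter a tau) (cn (j - a) (i.+1 - j.*2) (i - a.*2)))
       (malg_map (iter j tau) (cn (b - j) (i.+2 - b.*2) (i.+1 - j.*2) x)).
rewrite raddf_sum /=; transitivity (\sum_(a <= j < b.+1 | (j < (i.+1./2).+1)%N) H j).
  rewrite -(big_mkord (fun j => (j <= b)%N && (a <= j)%N) H).
  rewrite -big_filter -[RHS]big_filter.
  apply: perm_big; apply: uniq_perm; rewrite ?filter_uniq ?iota_uniq //.
  by move=> j; rewrite !mem_filter !mem_index_iota; lia.
have [ab | ba] := leqP a b; last first.
  by rewrite big_geq // big1.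
rewrite (big_addn 0 b.+1 a) subSn // big_mkord.
(* The bound [2 j <= i + 1] on the middle summand is the condition on [r] in the homotopy sum. *)
apply: eq_big => [r | r rL]; first by have := ltn_ord r; lia.
have rE : ((i - a.*2).+1 - r.*2 = i.+1 - (r + a).*2)%N by lia.
have E := @malg_map_comp _ A A A _ (iter r tau) (iter a tau) (iter (r + a) tau).
rewrite /H /homotopy_term rE addnK malg_map_lin_ext -E; last first.
  by move=> y; rewrite /= -iterD addnC.
by have -> : (b - a - r = b - (r + a))%N by lia.
Qed.

(** Only components with [b = a + 1] survive, where the homotopy sum is [f I]; the twist [tau^a]
    fixes it since [tau f = f]. *)
Lemma T_diff_sq i (v : {malg A^c[TA i.+2]}) :
  lin_ext (D i) (lin_ext (D i.+1) v) = lin_ext (cfmx_scalar f) (shift v).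
Proof.
rewrite /shift !linear_lin_ext_comp; apply: eq_lin_ext => -[b x].
rewrite T_diffE linear_sum /=.
under eq_bigr => j _ do rewrite T_diff_inc.
rewrite (exchange_big_dep xpredT) //=.
have hb := ltn_ord b.
transitivity (\sum_(a < (i./2).+1) inc (malg_map (iter a tau)
      (\sum_(r < (b - a).+1 | (a <= b)%N && (r.*2 <= (i - a.*2).+1)%N)
         homotopy_term (b - a) (i - a.*2) r x))).
  by apply: eq_bigr => a _; rewrite -T_diff_sq_component /inc linear_sum.
pose E (a : 'I_(i./2).+1) :=
  \sum_(r < (b - a).+1 | (a <= b)%N && (r.*2 <= (i - a.*2).+1)%N)
         homotopy_term (b - a) (i - a.*2) r x.
have E0 (a : 'I_(i./2).+1) :
    (b != a.+1 :> nat) -> inc (malg_map (iter a tau) (E a)) = 0.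
  move=> ba; suff -> : E a = 0 by rewrite raddf0 /inc linear0.
  have ha := ltn_ord a; rewrite /E.
  have [ab | ba'] := leqP a b; last by rewrite big_pred0.
  by apply: homotopy_sum0; lia.
(* For [b = 0] there is no target [a = b - 1], in agreement with [shift] killing this summand. *)
have [b' bE | bE] := unliftP ord0 b; last first.
  rewrite big1 => [|a _]; last by apply: E0; rewrite bE.
  by subst b; rewrite /= linear0.
rewrite (bigD1 b') //= [X in _ + X]big1 ?addr0 => [|a ab]; last first.
  by apply: (E0 a); rewrite bE /= /bump /= add1n eqSS eq_sym.
subst b; have b1 : (lift ord0 b' - b' = 1)%N by rewrite /= /bump /=; lia.
have Eb : E b' = cfmx_scalar f (x : I (i - b'.*2)%N).
  rewrite -[RHS](homotopy_sum1 (x : I (i - b'.*2)%N)) /E b1.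
  by apply: eq_bigl => r; rewrite /= /bump /=; lia.
rewrite -/(E b') Eb {Eb E0 E b1} /cfmx_scalar malg_mapU /= iter_tau_f /inc lin_extU.
rewrite -[RHS]/(lin_ext _ (shift_basis (existT _ (lift ord0 b') x))).
by rewrite shift_basis_lift lin_extU1 /cfmx_scalar /T_incl -malgU_scale.
Qed.

(** * Exactness of the lift modulo [f] *)

Lemma T_diff_top i (w : {malg A^c[I i.+1]}) :
  lin_ext (D i) (inc (i := i.+1) (a := ord0) w)
  = inc (i := i) (a := ord0) (lin_ext (cn 0 i.+1 (i - 0)) w).
Proof.
rewrite [LHS](T_diff_inc (i := i) (b := ord0) w) big_mkcond big_ord_recl.
rewrite [X in _ X = _]big1 // Monoid.mulm1; apply: (congr1 (@inc i ord0)).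
by apply: eq_lin_ext => y; exact: malg_map_id.
Qed.

Lemma T_diff_top0 (w : {malg A^c[I 1%N]}) :
  lin_ext (D 0) (inc (i := 1) (a := ord0) w)
  = inc (i := 0) (a := ord0) (lin_ext (@d 0) w).
Proof.
rewrite T_diff_top; apply: (congr1 (@inc 0 ord0)).
by apply: eq_lin_ext => y; exact: cn0E.
Qed.

Lemma T_diff_topS i (w : {malg A^c[I i.+2]}) :
  lin_ext (D i.+1) (inc (i := i.+2) (a := ord0) w)
  = inc (i := i.+1) (a := ord0) (lin_ext (@d i.+1) w).
Proof.
rewrite T_diff_top; apply: (congr1 (@inc i.+1 ord0)).
by apply: eq_lin_ext => y; exact: cn0E.
Qed.

Lemma T_diff_top_eq0 i (w : {malg A^c[I i.+1]}) :
  lin_ext (D i) (inc (i := i.+1) (a := ord0) w) = 0 -> lin_ext (@d i) w = 0.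
Proof. by case: i w => [|i] w; rewrite (T_diff_top0, T_diff_topS) => /inc_eq0. Qed.

(** With [D (D x) = f (shift x)] and [f] regular, [D x = f y] forces
    [shift x = shift (D z)] for the [z] with [shift z = y]; so [x - D z] lies in
    the summand [P_(i+1)], where it is killed by [d]. *)
Lemma T_diff_exact i (x : {malg A^c[TA i.+1]}) (y : {malg A^c[TA i]}) :
  lin_ext (D i) x = lin_ext (cfmx_scalar f) y ->
  exists z, x = lin_ext (D i.+1) z.
Proof.
move=> xy; pose z := unshift y; pose x' := x - lin_ext (D i.+1) z.
have Dx' : lin_ext (D i) x' = 0.
  by rewrite /x' linearB /= T_diff_sq shift_unshift xy subrr.
have [w wE] : exists w, x' = inc (i := i.+1) (a := ord0) w.
  (* For [i = 0] the summand [b = 0] is the only one. *)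
  case: i x y xy @z @x' Dx' => [|i] x y xy z x' _; first exact: inc_top1.
  apply: shift_eq0; rewrite /x' /shift linearB /= -!/(shift _) shift_T_diff.
  (* Multiplied by [f], the difference becomes [D (f y) - f ((tau . D) y)], which is zero. *)
  rewrite shift_unshift; apply: (lin_ext_scalar_eq0 f_regular).
  rewrite linearB /= -T_diff_sq xy.
  by rewrite (lin_ext_scalar_comm ftau) subrr.
move: Dx'; rewrite wE => /T_diff_top_eq0/dd0[u uE].
exists (z + inc (i := i.+2) (a := ord0) u).
by rewrite linearD /= T_diff_topS -uE -wE addrC subrK.
Qed.

Lemma inc_top0 (v : {malg A^c[TA 0]}) : exists w : {malg A^c[I 0%N]},
  v = inc (i := 0) (a := ord0) w.
Proof.
pose top0 (t : TA 0) : {malg A^c[I 0%N]} :=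
  let: existT (Ordinal b hb) x := t in
  match b return (b < 1)%N -> I (0 - b.*2) -> {malg A^c[I 0%N]} with
  | 0 => fun _ x => << 1 *g x >>
  | b'.+1 => fun _ _ => 0
  end hb x.
exists (lin_ext top0 v); rewrite /inc linear_lin_ext_comp.
rewrite [LHS](linear_lin_ext idfun); apply: eq_lin_ext => -[[[|b] hb] x] //=.
by rewrite lin_extU1; exact: T_elt_irr.
Qed.

(** * Entries of the lift: reduction to [B] and degrees *)

Lemma inc_coeff_neq i (a a' : 'I_(i./2).+1) w x : a != a' ->
  (inc (a := a) w)@_(Tagged (fun b : 'I_(i./2).+1 => I (i - b.*2)%N : Type)
    (i := a') x) = 0.
Proof.
move=> aa'; rewrite /inc /lin_ext raddf_sum /= big1 // => y _.
by rewrite mcoeffZ mcoeffU -tag_eqE /tag_eq /= (negbTE aa') mulr0.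
Qed.

Lemma T_diff_coeff i (b : 'I_(i.+1./2).+1) (a : 'I_(i./2).+1) (x : I (i.+1 - b.*2))
    (y : I (i - a.*2)) :
  (D i (Tagged (fun b : 'I_(i.+1./2).+1 => I (i.+1 - b.*2)%N : Type) x))
    @_(Tagged (fun b : 'I_(i./2).+1 => I (i - b.*2)%N : Type) y)
  = if (a <= b)%N then iter a tau (cn (b - a) (i.+1 - b.*2) (i - a.*2) x)@_y else 0.
Proof.
rewrite T_diffE raddf_sum /= big_mkcond (bigD1 a) //= big1 ?addr0.
  by case: ifP => // _; rewrite inc_coeff malg_mapE.
move=> a' /negbTE aa'; case: ifP => // _; rewrite inc_coeff_neq //.
by rewrite aa'.
Qed.

Lemma malg_map_inc (B : cgAlg k) (pi : {lrmorphism A -> B}) i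
    (a : 'I_(i./2).+1) (w : {malg A^c[I (i - a.*2)]}) :
  malg_map pi (inc w) = lin_ext (@T_incl k I B i a) (malg_map pi w).
Proof.
rewrite /inc malg_map_lin_ext; apply: eq_lin_ext => y.
by rewrite /cfmx_map -/(malg_map _ _) malg_mapU1.
Qed.

Lemma T_diff_pi (B : cgAlg k) (pi : {lrmorphism A -> B}) i t :
  T_diff tau c pi i t = malg_map pi (D i t).
Proof.
case: t => b x; rewrite T_diffE raddf_sum; apply: eq_bigr => a _.
exact: (esym (malg_map_inc pi _)).
Qed.

Lemma lin_ext_T_diff (B : cgAlg k) (pi : {lrmorphism A -> B}) i
    (v : {malg A^c[TA i.+1]}) :
  lin_ext (T_diff tau c pi i) (malg_map pi v) = malg_map pi (lin_ext (D i) v).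
Proof. by rewrite malg_map_lin_ext; apply: eq_lin_ext => t; exact: T_diff_pi. Qed.

Context (tau_gr : forall i a, cga_gr i a -> cga_gr i (tau a)).
Context (d_gr : forall n x, free_gr (@deg n) (deg x) (@d n x)).

Lemma iter_tau_gr n i a : cga_gr i a -> cga_gr i (iter n tau a).
Proof. by move=> Ga; elim: n => //= n; exact: tau_gr. Qed.

(** [hf_hom] covers [n >= 1]; for [n = 0] the matrix is [d], homogeneous by [d_gr]. *)
Lemma cn_gr n l l' x y : (l + n.*2 = l'.+1)%N ->
  cga_gr (deg x + (n * m)%N%:Z - deg y) ((cn n l l' x)@_y : A).
Proof.
move=> ll'; case: n ll' => [|n] ll'.
  rewrite addn0 in ll'; subst l; rewrite cn0E mul0n addr0; exact: d_gr.
have := hf_hom c_fam (n := n.+1) (l := l%:Z) isT.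
have -> : l%:Z + n.+1.*2%:Z - 1 = l'%:Z by lia.
by move=> /(_ x y).
Qed.

Lemma T_diff_coeff_gr i (t : TA i.+1) (t' : TA i) :
  cga_gr (T_deg m deg t - T_deg m deg t') ((D i t)@_t' : A).
Proof.
case: t t' => b x [a y]; have ha := ltn_ord a; have hb := ltn_ord b.
rewrite T_diff_coeff; case: ifP => [ab | _]; last exact: (grading0 (cga_grading A)).
apply: iter_tau_gr; have -> : T_deg m deg (existT _ b x) - T_deg m deg (existT _ a y)
    = deg x + ((b - a) * m)%N%:Z - deg y.
  rewrite /T_deg /= mulnBl; have : (a * m <= b * m)%N by rewrite leq_mul2r ab orbT.
  move: (deg x) (deg y) (a * m)%N (b * m)%N => u v p q pq. lia.
by apply: cn_gr; lia.
Qed.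

Lemma T_diff_coeff_aug i (t : TA i.+1) (t' : TA i) :
  (forall n (x : I n), deg x = n%:Z) -> (2 <= m)%N -> aug_ideal ((D i t)@_t' : A).
Proof.
move=> degE m2; have := T_diff_coeff_gr t t'.
case: t t' => b x [a y]; have ha := ltn_ord a; have hb := ltn_ord b.
rewrite T_diff_coeff; case: ifP => [ab | _]; last by move=> _; exact: gspan0.
move=> G1; rewrite -[X in aug_ideal X]addr0; apply: (gspanD _ G1 (gspan0 _ _)).
rewrite /T_deg /= !degE.
(* Abstracting the products [a * m] and [b * m] to [p] and [q] makes the bound linear; the last
   premise records [2 (b - a) <= (b - a) m]. *)
have arith (a' b' p q : nat) : (a' <= i./2)%N -> (b' <= i.+1./2)%N ->
    (a' <= b')%N -> (p <= q)%N -> (b' * 2 - a' * 2 <= q - p)%N ->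
    1 <= (i.+1 - b'.*2)%N%:Z + q%:Z - ((i - a'.*2)%N%:Z + p%:Z) by lia.
apply: arith => //; first by rewrite leq_mul2r ab orbT.
by rewrite -!mulnBl leq_mul2l m2 orbT.
Qed.

End Construction.

(** * The resolution of the trivial [B]-module *)

Lemma inverse_rmorphism (R : pzRingType) (sigma : {rmorphism R -> R}) (tau : R -> R) :
  cancel sigma tau -> cancel tau sigma ->
  exists t : {rmorphism R -> R}, tau = t :> (R -> R).
Proof.
move=> sK tK; exists (HB.pack_for {rmorphism R -> R} tau
  (GRing.isZmodMorphism.Build R R tau (can2_zmod_morphism sK tK))
  (GRing.isMonoidMorphism.Build R R tau (can2_monoid_morphism sK tK))).
by [].
Qed.

Theorem theorem1p2 (k : closedFieldType) (char0 : [pchar k] =i pred0)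
  (A : cgAlg k) (m : nat) (f : A) (m_ge1 : (1 <= m)%N)
  (f_deg : cga_gr m%:Z f) (f_regular : regular_elt f) (f_normal : normal_elt f)
  (sigma : {lrmorphism A -> A}) (sigma_norm : normalizing_aut f sigma)
  (tau : A -> A) (sigmaK : cancel sigma tau) (tauK : cancel tau sigma)
  (B : cgAlg k) (pi : {lrmorphism A -> B}) (B_quot : graded_quotient f pi)
  (I : nat -> choiceType) (deg : forall n, I n -> int)
  (d : forall n, cfmx A (I n.+1) (I n)) (e : I 0%N -> triv_mod A)
  (P_res : gminimal_resolution (N := triv_mod A)
     (P := fun n => free_mod A (@deg n)) (fun n => lin_ext (@d n)) (lin_ext e))
  (c : nat -> forall l l' : int, cfmx A (ext_basis I l) (ext_basis I l'))
  (c_fam : homotopy_family m f tau deg d c) :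
  gresolution (N := triv_mod B) (P := fun i => T_mod m deg B i)
    (fun i => lin_ext (T_diff tau c pi i)) (lin_ext (T_aug B e))
  /\ (koszul A -> (2 <= m)%N ->
      gminimal_resolution (N := triv_mod B) (P := fun i => T_mod m deg B i)
        (fun i => lin_ext (T_diff tau c pi i))
        (lin_ext (T_aug B e))).
Proof.
have [_ sigma_gr sigma_f] := sigma_norm.
have tau_gr i a : cga_gr i a -> cga_gr i (tau a).
  by move=> Ga; apply/sigma_gr; rewrite tauK.
have ftau a : a * f = f * tau a by rewrite sigma_f tauK.
(* Since [f f = sigma(f) f], the factor [f] can be cancelled on the right. *)
have fixed_f : sigma f = f.
  apply/esym/eqP; rewrite -subr_eq0; apply/eqP.
  by apply: f_regular; left; rewrite mulrBl -sigma_f subrr.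
have tau_f : tau f = f by rewrite -{1}fixed_f sigmaK.
have norm_f a : exists b, f * a = b * f by exists (sigma a).
(* [tau] is given as a mere function; being inverse to [sigma], it is a ring morphism. *)
have [tau' tauE] := inverse_rmorphism sigmaK tauK.
move: tau_gr ftau tau_f c_fam.
rewrite tauE {tau sigmaK tauK tauE} => tau_gr ftau tau_f c_fam.
have [[he hd e_surj e0 d0] _] := P_res.
have d_gr n x : free_gr (deg n) (deg n.+1 x) (d n x) by exact: ghom_basis_gr (hd n).
have eps_T (v : {malg A^c[I 0%N]}) :
    lin_ext (T_aug B e) (malg_map pi (inc (i := 0) (a := ord0) v)) = lin_ext e v :> k.
  rewrite (lin_ext_triv_pi B_quot) /inc linear_lin_ext_comp.
  by apply: (@eq_lin_ext _ _ _ (triv_mod A)) => x; exact: lin_extU1.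
have res : gresolution (N := triv_mod B) (P := fun i => T_mod m deg B i)
    (fun i => lin_ext (T_diff tau' c pi i)) (lin_ext (T_aug B e)).
  split.
  - apply: lin_ext_ghom => -[[b hb] x]; have b0 : b = 0%N by case: b hb {x}.
    move: hb x; rewrite b0 => hb x.
    have := ghom_basis_gr x he; rewrite /T_deg /= mul0n addr0; exact.
  - move=> i; apply: lin_ext_ghom => t t'; rewrite T_diff_pi malg_mapE.
    case: B_quot => _ piG _; apply/piG; exists ((T_diff tau' c idfun i t)@_t') => //.
    exact: (T_diff_coeff_gr c_fam tau_gr d_gr).
  - move=> y; have [u uE] := e_surj y.
    by exists (malg_map pi (inc (i := 0) (a := ord0) u)); rewrite eps_T.
  - move=> x; split=> [x0 | [y ->]].
      (* Lifted to [A], an element killed by the augmentation is a vector of [P_0] with the same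
         property, hence in the image of [d 0]. *)
      have [v vE] := malg_map_pi_surj B_quot x; have [w wE] := inc_top0 v.
      have /e0[u uE] : lin_ext e w = 0 by rewrite -[LHS]eps_T -wE vE.
      exists (malg_map pi (inc (i := 1) (a := ord0) u)).
      by rewrite lin_ext_T_diff (T_diff_top0 c_fam) -uE -wE vE.
    have [v <-] := malg_map_pi_surj B_quot y; have [w ->] := inc_top1 v.
    rewrite lin_ext_T_diff (T_diff_top0 c_fam) [LHS]eps_T.
    by apply/e0; exists w.
  - move=> i x; split=> [x0 | [y ->]].
      (* A cycle over [B] lifts to [v] with [D v] divisible by [f], the hypothesis of
         [T_diff_exact]. *)
      have [v vE] := malg_map_pi_surj B_quot x.
      have [y yE] : exists y, lin_ext (T_diff tau' c idfun i) v
          = lin_ext (cfmx_scalar f) y.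
        by apply: (malg_map_pi_eq0 ftau norm_f B_quot); rewrite -lin_ext_T_diff vE.
      have [z zE] := T_diff_exact c_fam f_regular tau_f ftau d0 yE.
      by exists (malg_map pi z); rewrite lin_ext_T_diff -zE vE.
    (* Conversely [D (D v)] is a multiple of [f] and vanishes in [B]. *)
    have [v <-] := malg_map_pi_surj B_quot y.
    rewrite !lin_ext_T_diff (T_diff_sq c_fam tau_f d0).
    exact: (malg_map_pi_scalar B_quot).
split=> // koszulA m2; split=> // i x.
have degE := koszul_deg P_res koszulA.
have [v <-] := malg_map_pi_surj B_quot x.
(* The entries of [D] lie in [A_{>=1}], and [pi] maps this ideal into [B_{>=1}]. *)
apply/rspan_aug_coeff => t; rewrite lin_ext_T_diff malg_mapE.
apply: (aug_ideal_pi B_quot).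
rewrite /lin_ext; elim: (enum_fset _) => [|s r IH].
  by rewrite big_nil mcoeff0; exact: gspan0.
rewrite big_cons mcoeffD; apply: gspan_add IH; rewrite mcoeffZ.
by apply: aug_ideal_mulr; exact: (T_diff_coeff_aug c_fam tau_gr d_gr s t degE m2).
Qed.
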